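(* Let $0\le\alpha<1$ and suppose $f=h+\overline{g}\in \mathcal{W}^{0}_{H}(\alpha)$, with $h(z)=z+\sum_{n=2}^{\infty}a_nz^n$ and $g(z)=\sum_{n=2}^{\infty}b_nz^n$. Then $$|f(z)|+|z|+\sum_{n=2}^{\infty}(|a_n|+|b_n|)|z|^n\le d(f(0),\partial f(\mathbb{D}))$$ for $|z|=r\le r_3$, where $r_3$ is the unique root of the equation $$4\sum_{n=2}^{\infty}\frac{r^n}{\alpha n^2+n(1-\alpha)}+2r-1-2\sum_{n=2}^{\infty}\frac{(-1)^{n-1}}{\alpha n^2+n(1-\alpha)}=0$$ in the interval $(0,1)$. The radius $r_3$ is best possible, i.e. it cannot be replaced by a larger number for which the inequality still holds for all $f\in\mathcal{W}^{0}_{H}(\alpha)$.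
   Context: $\mathbb{D}=\{z\in\mathbb{C}:|z|<1\}$. $\mathcal{H}$ is the class of complex-valued harmonic functions $f=h+\overline{g}$ on $\mathbb{D}$ with $h,g$ analytic in $\mathbb{D}$, $h(0)=h'(0)-1=0$ and $g(0)=0$. $\mathcal{H}_0=\{f=h+\overline{g}\in\mathcal{H}: g'(0)=0\}$; each $f\in\mathcal{H}_0$ has $h(z)=z+\sum_{n\ge2}a_nz^n$, $g(z)=\sum_{n\ge2}b_nz^n$. For $0\le\alpha<1$, $$\mathcal{W}^{0}_{H}(\alpha)=\left\{f=h+\overline{g}\in\mathcal{H}_0:\ \mathrm{Re}\left(h'(z)+\alpha zh''(z)\right)>\left|g'(z)+\alpha zg''(z)\right|,\ z\in\mathbb{D}\right\}.$$ $d(f(0),\partial f(\mathbb{D}))$ denotes the Euclidean distance between $f(0)$ and the boundary of $f(\mathbb{D})$. *)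

(* Defs.v *)
From Stdlib Require Import Reals.
From Coquelicot Require Import Coquelicot.

Open Scope R_scope.

Definition unit_disk (z : C) : Prop := Cmod z < 1.

(** Analytic means complex differentiable at every point of the disk: the
    derivative is taken over the field [C], not over [R]. *)
Definition analytic_on_disk (h : C -> C) : Prop :=
  forall z : C, unit_disk z ->
    @ex_derive C_AbsRing C_NormedModule h z.

(** The functions are total on [C], but only their values on the unit disk are
    ever constrained or used.  The analytic and co-analytic parts [h] and [g]
    are determined on the disk by [f], thanks to [g 0 = 0]. *)
Definition class_H (f h g : C -> C) : Prop :=
  analytic_on_disk h /\ analytic_on_disk g /\
  (forall z : C, unit_disk z -> f z = (h z + Cconj (g z))%C) /\
  h (RtoC 0) = RtoC 0 /\ C_derive h (RtoC 0) = RtoC 1 /\ g (RtoC 0) = RtoC 0.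

Definition class_H0 (f h g : C -> C) : Prop :=
  class_H f h g /\ C_derive g (RtoC 0) = RtoC 0.

Definition class_W0H (alpha : R) (f h g : C -> C) : Prop :=
  class_H0 f h g /\
  forall z : C, unit_disk z ->
    Cmod (C_derive g z + RtoC alpha * z * C_derive (C_derive g) z)%C
    < Re (C_derive h z + RtoC alpha * z * C_derive (C_derive h) z)%C.

(** [h(z) = z + sum_(n >= 2) a_n z^n] and [g(z) = sum_(n >= 2) b_n z^n] on the
    disk; [a 0], [a 1], [b 0] and [b 1] are irrelevant. *)
Definition expansions (h g : C -> C) (a b : nat -> C) : Prop :=
  forall z : C, unit_disk z ->
    @is_series C_AbsRing C_NormedModule
      (fun k => (a (2 + k)%nat * z ^ (2 + k))%C) (h z - z)%C /\
    @is_series C_AbsRing C_NormedModule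
      (fun k => (b (2 + k)%nat * z ^ (2 + k))%C) (g z).

(** [sum_(n >= 2) u n] *)
Definition sum_from_2 (u : nat -> R) : R := Series (fun k => u (2 + k)%nat).

Definition image_of_disk (f : C -> C) (w : C) : Prop :=
  exists z : C, unit_disk z /\ f z = w.

Definition boundary (A : C -> Prop) (w : C) : Prop :=
  forall eps : R, 0 < eps ->
    (exists u : C, A u /\ Cmod (u - w)%C < eps) /\
    (exists u : C, ~ A u /\ Cmod (u - w)%C < eps).

(** The infimum is taken in the extended reals, with value [+oo] on the empty
    set. *)
Definition dist_to_set (p : C) (A : C -> Prop) : Rbar :=
  Glb_Rbar (fun d => exists w : C, A w /\ d = Cmod (w - p)%C).

(** When [a] and [b] satisfy [expansions] and [z] lies in the disk, the series
    below converges, since power series converge absolutely inside their disk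
    of convergence; so [Series] is its genuine sum. *)
Definition bohr_inequality (f : C -> C) (a b : nat -> C) (z : C) : Prop :=
  Rbar_le
    (Finite (Cmod (f z) + Cmod z
             + sum_from_2 (fun n => (Cmod (a n) + Cmod (b n)) * Cmod z ^ n)))
    (dist_to_set (f (RtoC 0)) (boundary (image_of_disk f))).

Definition bohr_inequality_up_to (alpha rho : R) : Prop :=
  forall (f h g : C -> C) (a b : nat -> C),
    class_W0H alpha f h g -> expansions h g a b ->
    forall z : C, unit_disk z -> Cmod z <= rho -> bohr_inequality f a b z.

Definition radius_weight (alpha : R) (n : nat) : R :=
  alpha * INR n ^ 2 + INR n * (1 - alpha).

Definition radius_function (alpha r : R) : R :=
  4 * sum_from_2 (fun n => r ^ n / radius_weight alpha n) + 2 * r - 1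
  - 2 * sum_from_2 (fun n => (-1) ^ (n - 1) / radius_weight alpha n).

(* Main.v *)
(* Put [w n = alpha n^2 + n (1 - alpha)].  For every unimodular constant [e], the function
   [H + e G] built from [H = h' + alpha z h''] and [G = g' + alpha z g''] has positive real
   part; its coefficients are [w (n+1) (a_(n+1) + e b_(n+1))].
   - Integrating the real part against nonnegative trigonometric kernels gives
     Caratheodory's bound, hence [|a_n| + |b_n| <= 2 / w n], and Harnack's inequality
     [Re (H + e G) >= (1 - r) / (1 + r)].
   - The operators [u |-> u + alpha t u'] and [u |-> u + t u'] on a radius can be inverted
     preserving inequalities (look at the minimum of [u]).  This turns Harnack's inequality
     into a positive lower bound for [Re h' - |g'|] and into
     [Re (h z / z) - |g z / z| >= L r / r], where
     [L r = r + 2 sum_(n >= 2) (-1)^(n-1) r^n / w n].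
   - The first bound makes [f] strongly monotone on smaller disks, the second one points
     [f - c] outwards on [|z| = r] when [|c| < L r]; by a Browder-Minty argument [f] takes
     every such value [c].  Hence the boundary of the image has distance at least
     [L 1] from [f 0 = 0], without using that [f] is univalent or open.
   - For [h z = z + 2 sum z^n / w n] and [g = 0], monotonicity shows that only real points
     have real images, so that [- L 1] is a boundary point, and the Bohr sum at [r > 0] is
     [radius_function alpha r + L 1]. *)

Require Import Defs.
From Stdlib Require Import Reals Lra Lia ZArith.
From Coquelicot Require Import Coquelicot.
Open Scope R_scope.

(** Membership in the class says nothing about boundary values. The integral arguments therefore act
    on dilated coefficients [q n * rho ^ n], with trigonometric polynomials as kernels; only finite
    sums are integrated, and [rho] tends to 1 afterwards. The inversions come in a pair because
    [w (n+1) = (1 + alpha n) (n + 1)]: the factors are the multipliers of [u + alpha t u'] and of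
    [u + t u'], the second leading from [h'] to [h z / z]. The series [L r / r] is the exact
    preimage of Harnack's bound [(1 - r) / (1 + r)] under both operators, so the function with
    [H = (1 + z) / (1 - z)] attains it on the negative axis. The constant [e] may be chosen anew at
    each point or index: opposing the two parts yields [Re h' - |g'|], aligning them yields
    [|a_n| + |b_n|]. [L r] is available for [r < 1] only, and Abel's theorem carries it to [L 1].
    The estimate [0 < L 1 <= 1] for the alternating series decides the signs of the radius equation
    at 0 and at 1/2, hence the existence of the root. *)

(** * Complex series through real and imaginary parts *)

Notation is_cseries := (@is_series C_AbsRing C_NormedModule).

Lemma ex_Rseries_ext (u v : nat -> R) :
  (forall n, u n = v n) -> ex_series u -> ex_series v.
Proof. apply ex_series_ext. Qed.

Lemma ex_Rseries_le (u v : nat -> R) :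
  (forall n, Rabs (u n) <= v n) -> ex_series v -> ex_series u.
Proof. apply (@ex_series_le R_AbsRing R_CompleteNormedModule). Qed.

Lemma is_Rseries_scal (c : R) (u : nat -> R) (l : R) :
  is_series u l -> is_series (fun n => c * u n) (c * l).
Proof. apply (@is_series_scal R_AbsRing R_NormedModule). Qed.

Lemma is_Rseries_minus (u v : nat -> R) (l m : R) :
  is_series u l -> is_series v m -> is_series (fun n => u n - v n) (l - m).
Proof. apply (@is_series_minus R_AbsRing R_NormedModule). Qed.

Lemma is_Rseries_ext (u v : nat -> R) (l : R) :
  (forall n, u n = v n) -> is_series u l -> is_series v l.
Proof. apply is_series_ext. Qed.

Lemma Re_sum_n (u : nat -> C) (n : nat) :
  Re (@sum_n C_AbelianMonoid u n) = sum_n (fun k => Re (u k)) n.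
Proof.
  induction n as [|n IH].
  - now rewrite !sum_O.
  - rewrite !sum_Sn, <- IH. reflexivity.
Qed.

Lemma Im_sum_n (u : nat -> C) (n : nat) :
  Im (@sum_n C_AbelianMonoid u n) = sum_n (fun k => Im (u k)) n.
Proof.
  induction n as [|n IH].
  - now rewrite !sum_O.
  - rewrite !sum_Sn, <- IH. reflexivity.
Qed.

(** The uniform structure of [C] is the product one: a ball is a pair of real balls, so the two
    coordinates converge separately. *)
Lemma is_cseries_iff (u : nat -> C) (l : C) :
  is_cseries u l <->
  is_series (fun n => Re (u n)) (Re l) /\ is_series (fun n => Im (u n)) (Im l).
Proof.
  assert (EC := @filterlim_locally nat C_UniformSpace eventually _
                  (@sum_n C_AbelianMonoid u) l).
  assert (ER := @filterlim_locally nat R_UniformSpace eventually _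
                  (sum_n (fun n => Re (u n))) (Re l)).
  assert (EI := @filterlim_locally nat R_UniformSpace eventually _
                  (sum_n (fun n => Im (u n))) (Im l)).
  split.
  - intros H0. assert (H := proj1 EC H0). split; [apply ER | apply EI]; intros eps;
      destruct (H eps) as [N HN]; exists N; intros n Hn;
      [rewrite <- Re_sum_n | rewrite <- Im_sum_n]; apply (HN n Hn).
  - intros [H1 H2]. apply EC. intros eps.
    destruct (proj1 ER H1 eps) as [N1 HN1], (proj1 EI H2 eps) as [N2 HN2].
    exists (max N1 N2). intros n Hn. split.
    + change (ball (Re l) eps (Re (@sum_n C_AbelianMonoid u n))). rewrite Re_sum_n.
      apply HN1; lia.
    + change (ball (Im l) eps (Im (@sum_n C_AbelianMonoid u n))). rewrite Im_sum_n.
      apply HN2; lia.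
Qed.

Lemma im_le_Cmod (c : C) : Rabs (Im c) <= Cmod c.
Proof.
  eapply Rle_trans; [apply Rmax_r | apply Rmax_Cmod].
Qed.

Lemma Re_le_Cmod (c : C) : Re c <= Cmod c.
Proof. eapply Rle_trans; [apply Rle_abs | apply re_le_Cmod]. Qed.

Lemma Cmod_le_Re_Im (c : C) : Cmod c <= Rabs (Re c) + Rabs (Im c).
Proof.
  assert (E : c = Cplus (RtoC (Re c)) (Cmult Ci (RtoC (Im c)))).
  { destruct c as [x y]. unfold Cplus, Cmult, Ci, RtoC; simpl. f_equal; ring. }
  rewrite E at 1. eapply Rle_trans; [apply Cmod_triangle|].
  rewrite Cmod_mult, Cmod_Ci, !Cmod_R. lra.
Qed.

(** Total, like [Series]: the value is meaningful only under a convergence hypothesis, which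
    absolute convergence supplies below. *)
Definition csum (u : nat -> C) : C :=
  (Series (fun n => Re (u n)), Series (fun n => Im (u n))).

Lemma csum_ext (u v : nat -> C) : (forall n, u n = v n) -> csum u = csum v.
Proof.
  intros H. unfold csum. f_equal; apply Series_ext; intros n; now rewrite H.
Qed.

Lemma csum_correct (u : nat -> C) :
  ex_series (fun n => Cmod (u n)) -> is_cseries u (csum u).
Proof.
  intros H. apply is_cseries_iff; split; apply Series_correct;
    apply ex_Rseries_le with (2 := H); intros n.
  - apply re_le_Cmod.
  - apply im_le_Cmod.
Qed.

Lemma is_cseries_unique (u : nat -> C) (l1 l2 : C) :
  is_cseries u l1 -> is_cseries u l2 -> l1 = l2.
Proof.
  rewrite !is_cseries_iff. intros [A1 B1] [A2 B2].
  apply is_series_unique in A1, A2, B1, B2.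
  destruct l1, l2; simpl in *; congruence.
Qed.

Lemma is_cseries_ext (u v : nat -> C) (l : C) :
  (forall n, u n = v n) -> is_cseries u l -> is_cseries v l.
Proof. apply is_series_ext. Qed.

Lemma is_cseries_plus (u v : nat -> C) (l m : C) :
  is_cseries u l -> is_cseries v m -> is_cseries (fun n => u n + v n)%C (l + m)%C.
Proof. intros; now apply (@is_series_plus C_AbsRing C_NormedModule). Qed.

Lemma is_cseries_scal (c : C) (u : nat -> C) (l : C) :
  is_cseries u l -> is_cseries (fun n => c * u n)%C (c * l)%C.
Proof. intros; now apply (@is_series_scal C_AbsRing C_NormedModule). Qed.

Lemma is_cseries_minus (u v : nat -> C) (l m : C) :
  is_cseries u l -> is_cseries v m -> is_cseries (fun n => u n - v n)%C (l - m)%C.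
Proof. intros; now apply (@is_series_minus C_AbsRing C_NormedModule). Qed.

(** The rotation [Cconj l / Cmod l], or 1 when [l = 0]. It turns a modulus into a real part, to
    which linear arguments apply. *)
Lemma Cmod_unimodular (l : C) : exists c : C, Cmod c = 1 /\ (c * l)%C = RtoC (Cmod l).
Proof.
  destruct (Ceq_dec l 0) as [E|E].
  - exists 1. split; [apply Cmod_1|]. rewrite E, Cmod_0. ring.
  - assert (H := proj1 (Cmod_gt_0 l) E).
    exists (RtoC (/ Cmod l) * Cconj l)%C. split.
    + rewrite Cmod_mult, Cmod_conj, Cmod_R, Rabs_right.
      * field; lra.
      * left; now apply Rinv_0_lt_compat.
    + rewrite <- Cmult_assoc, (Cmult_comm _ l), <- Cmod2_conj, <- RtoC_mult.
      f_equal. field; lra.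
Qed.

(** After a rotation making the sum a nonnegative real, the triangle inequality reduces to a
    termwise comparison of real parts with moduli. *)
Lemma Cmod_is_cseries_le (u : nat -> C) (l : C) (L : R) :
  is_cseries u l -> is_series (fun n => Cmod (u n)) L -> Cmod l <= L.
Proof.
  intros Hu HL. destruct (Cmod_unimodular l) as (c & Hc & E).
  replace (Cmod l) with (Re (c * l)) by now rewrite E, re_RtoC.
  apply (is_cseries_scal c) in Hu. apply is_cseries_iff in Hu as [Hu _].
  rewrite <- (is_series_unique _ _ Hu), <- (is_series_unique _ _ HL).
  apply Rle_trans with (1 := Rle_abs _).
  assert (HB : forall n, Rabs (Re (c * u n)) <= Cmod (u n)).
  { intros n. eapply Rle_trans; [apply re_le_Cmod|]. rewrite Cmod_mult, Hc; lra. }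
  eapply Rle_trans; [apply Series_Rabs|].
  - apply ex_Rseries_le with (2 := ex_intro _ L HL).
    intros n. eapply Rle_trans; [|apply HB].
    rewrite Rabs_Rabsolu. lra.
  - apply Series_le; [|now exists L]. intros n; split; [apply Rabs_pos | apply HB].
Qed.

(** * Sequences whose power series converges absolutely in the unit disk *)

(** Amounts to a radius of convergence at least 1, in a form that termwise comparison preserves
    directly. *)
Definition disk_summable (c : nat -> R) : Prop :=
  forall r, 0 <= r < 1 -> ex_series (fun n => Rabs (c n) * r ^ n).

Lemma disk_summable_le (c d : nat -> R) :
  (forall n, Rabs (c n) <= Rabs (d n)) -> disk_summable d -> disk_summable c.
Proof.
  intros H Hd r Hr.
  apply ex_Rseries_le with (2 := Hd r Hr).
  intros n.
  assert (P := pow_le r n (proj1 Hr)).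
  rewrite Rabs_mult, Rabs_Rabsolu, (Rabs_right (r ^ n)) by lra.
  now apply Rmult_le_compat_r.
Qed.

(** Terms of a convergent series tend to 0, which is impossible beyond the radius of convergence; so
    that radius is at least the midpoint of [Rabs x] and 1. *)
Lemma disk_summable_of_ex_series (c : nat -> R) :
  (forall r, 0 <= r < 1 -> ex_series (fun n => c n * r ^ n)) ->
  forall x, Rabs x < 1 -> Rbar_lt (Rabs x) (CV_radius c).
Proof.
  intros H x Hx.
  set (r := (Rabs x + 1) / 2). assert (P := Rabs_pos x).
  assert (Hr : 0 <= r < 1) by (unfold r; lra).
  apply Rbar_lt_le_trans with (Finite r); [simpl; unfold r; lra|].
  apply Rbar_not_lt_le. intros Hlt.
  apply (CV_disk_outside c r).
  - now rewrite Rabs_right by lra.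
  - now apply ex_series_lim_0, H.
Qed.

Lemma disk_summable_CV_radius (c : nat -> R) (x : R) :
  disk_summable c -> Rabs x < 1 -> Rbar_lt (Rabs x) (CV_radius c).
Proof.
  intros H. apply disk_summable_of_ex_series. intros r Hr.
  apply ex_series_Rabs. apply ex_Rseries_ext with (2 := H r Hr).
  intros n. rewrite Rabs_mult, (Rabs_right (r ^ n)); auto.
  apply Rle_ge, pow_le; lra.
Qed.

Lemma CV_radius_disk_summable (c : nat -> R) :
  (forall x, Rabs x < 1 -> Rbar_lt (Rabs x) (CV_radius c)) -> disk_summable c.
Proof.
  intros H r Hr. assert (E : Rabs r = r) by (apply Rabs_right; lra).
  assert (K := CV_disk_inside c r (H r ltac:(lra))).
  apply ex_Rseries_ext with (2 := K). intros n.
  rewrite Rabs_mult, (Rabs_right (r ^ n)); auto.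
  apply Rle_ge, pow_le; lra.
Qed.

Lemma disk_summable_derive (c : nat -> R) :
  disk_summable c -> disk_summable (fun n => INR (S n) * c (S n)).
Proof.
  intros H. apply CV_radius_disk_summable. intros x Hx.
  change (fun n => INR (S n) * c (S n)) with (PS_derive c).
  rewrite CV_radius_derive. now apply disk_summable_CV_radius.
Qed.

Lemma disk_summable_shift (c : nat -> R) :
  disk_summable c -> disk_summable (fun n => c (S n)).
Proof.
  intros H. apply disk_summable_le with (2 := disk_summable_derive c H).
  intros n. rewrite Rabs_mult, (Rabs_right (INR (S n))) by (apply Rle_ge, pos_INR).
  assert (1 <= INR (S n)) by (rewrite S_INR; generalize (pos_INR n); lra).
  generalize (Rabs_pos (c (S n))); nra.
Qed.

Lemma disk_summable_mul_INR (c : nat -> R) :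
  disk_summable c -> disk_summable (fun n => INR n * c n).
Proof.
  intros H r Hr. apply ex_series_incr_1.
  apply ex_Rseries_ext with (fun n => r * (Rabs (INR (S n) * c (S n)) * r ^ n)).
  - intros n. rewrite <- tech_pow_Rmult. ring.
  - apply (@ex_series_scal R_AbsRing R_NormedModule). now apply disk_summable_derive.
Qed.

Lemma disk_summable_plus (c d : nat -> R) :
  disk_summable c -> disk_summable d -> disk_summable (fun n => c n + d n).
Proof.
  intros Hc Hd r Hr.
  apply ex_Rseries_le
    with (v := fun n => Rabs (c n) * r ^ n + Rabs (d n) * r ^ n).
  - intros n.
    assert (P := pow_le r n (proj1 Hr)).
    rewrite Rabs_mult, Rabs_Rabsolu, (Rabs_right (r ^ n)) by lra.
    generalize (Rabs_triang (c n) (d n)); nra.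
  - apply (@ex_series_plus R_AbsRing R_NormedModule); auto.
Qed.

Lemma disk_summable_scal (k : R) (c : nat -> R) :
  disk_summable c -> disk_summable (fun n => k * c n).
Proof.
  intros Hc r Hr.
  apply ex_Rseries_ext with (fun n => Rabs k * (Rabs (c n) * r ^ n)).
  - intros n. rewrite Rabs_mult. ring.
  - apply (@ex_series_scal R_AbsRing R_NormedModule); auto.
Qed.

Lemma disk_summable_bounded (c : nat -> R) (M : R) :
  (forall n, Rabs (c n) <= M) -> disk_summable c.
Proof.
  intros H r Hr.
  apply ex_Rseries_le with (v := fun n => M * r ^ n).
  - intros n.
    assert (P := pow_le r n (proj1 Hr)).
    rewrite Rabs_mult, Rabs_Rabsolu, (Rabs_right (r ^ n)) by lra.
    now apply Rmult_le_compat_r.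
  - apply (@ex_series_scal R_AbsRing R_NormedModule). apply ex_series_geom.
    rewrite Rabs_right; lra.
Qed.

(** * Complex power series in the unit disk *)

Definition cdisk_summable (a : nat -> C) : Prop := disk_summable (fun n => Cmod (a n)).

Definition cps (a : nat -> C) (z : C) : C := csum (fun n => a n * z ^ n)%C.

Lemma cdisk_summable_ex (a : nat -> C) (r : R) :
  cdisk_summable a -> 0 <= r < 1 -> ex_series (fun n => Cmod (a n) * r ^ n).
Proof.
  intros H Hr. apply ex_Rseries_ext with (2 := H r Hr). intros n.
  rewrite Rabs_right; auto. apply Rle_ge, Cmod_ge_0.
Qed.

Lemma cps_correct (a : nat -> C) (z : C) :
  cdisk_summable a -> Cmod z < 1 -> is_cseries (fun n => a n * z ^ n)%C (cps a z).
Proof.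
  intros H Hz. apply csum_correct.
  apply ex_Rseries_ext with (2 := cdisk_summable_ex a _ H (conj (Cmod_ge_0 z) Hz)).
  intros n. now rewrite Cmod_mult, Cmod_pow.
Qed.

Lemma cps_unique (a : nat -> C) (z l : C) :
  cdisk_summable a -> Cmod z < 1 -> is_cseries (fun n => a n * z ^ n)%C l -> cps a z = l.
Proof.
  intros H Hz Hl. apply is_cseries_unique with (2 := Hl). now apply cps_correct.
Qed.

(** It suffices to look at the points of [[0, 1)], where the real and imaginary parts are real power
    series with coefficients [Re (a n)] and [Im (a n)]. *)
Lemma cdisk_summable_of_converges (a : nat -> C) (h : C -> C) :
  (forall z, Cmod z < 1 -> is_cseries (fun n => a n * z ^ n)%C (h z)) ->
  cdisk_summable a.
Proof.
  intros H.
  assert (HR : forall r, 0 <= r < 1 -> Cmod (RtoC r) < 1)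
    by (intros r Hr; rewrite Cmod_R, Rabs_right; lra).
  apply disk_summable_le with (d := fun n => Rabs (Re (a n)) + Rabs (Im (a n))).
  { intros n. rewrite (Rabs_right (Cmod _)) by apply Rle_ge, Cmod_ge_0.
    eapply Rle_trans; [apply Cmod_le_Re_Im | apply Rle_abs]. }
  apply disk_summable_plus.
  - apply disk_summable_le with (d := fun n => Re (a n));
      [intros n; rewrite Rabs_Rabsolu; lra|].
    apply CV_radius_disk_summable, disk_summable_of_ex_series.
    intros r Hr. destruct (proj1 (is_cseries_iff _ _) (H r (HR r Hr))) as [A _].
    eexists. apply is_series_ext with (2 := A).
    intros n. now rewrite <- RtoC_pow, re_scal_r.
  - apply disk_summable_le with (d := fun n => Im (a n));
      [intros n; rewrite Rabs_Rabsolu; lra|].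
    apply CV_radius_disk_summable, disk_summable_of_ex_series.
    intros r Hr. destruct (proj1 (is_cseries_iff _ _) (H r (HR r Hr))) as [_ A].
    eexists. apply is_series_ext with (2 := A).
    intros n. now rewrite <- RtoC_pow, im_scal_r.
Qed.

Lemma cdisk_summable_shift (a : nat -> C) :
  cdisk_summable a -> cdisk_summable (fun n => a (S n)).
Proof. apply (disk_summable_shift (fun n => Cmod (a n))). Qed.

Lemma cdisk_summable_mul (k : nat -> R) (a : nat -> C) :
  (forall n, 0 <= k n) ->
  disk_summable (fun n => k n * Cmod (a n)) ->
  cdisk_summable (fun n => RtoC (k n) * a n)%C.
Proof.
  intros Hk. apply disk_summable_le. intros n.
  rewrite Cmod_mult, Cmod_R, (Rabs_right (k n)) by (apply Rle_ge, Hk). lra.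
Qed.

Lemma cdisk_summable_mul_INR (a : nat -> C) :
  cdisk_summable a -> cdisk_summable (fun n => RtoC (INR n) * a n)%C.
Proof.
  intros H. apply cdisk_summable_mul; [apply pos_INR|]. now apply disk_summable_mul_INR.
Qed.

Lemma cdisk_summable_plus (a b : nat -> C) :
  cdisk_summable a -> cdisk_summable b -> cdisk_summable (fun n => a n + b n)%C.
Proof.
  intros Ha Hb. apply disk_summable_le with (2 := disk_summable_plus _ _ Ha Hb).
  intros n. rewrite !Rabs_right.
  - apply Cmod_triangle.
  - apply Rle_ge, Rplus_le_le_0_compat; apply Cmod_ge_0.
  - apply Rle_ge, Cmod_ge_0.
Qed.

Lemma cdisk_summable_scal (c : C) (a : nat -> C) :
  cdisk_summable a -> cdisk_summable (fun n => c * a n)%C.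
Proof.
  intros Ha. apply disk_summable_le with (2 := disk_summable_scal (Cmod c) _ Ha).
  intros n. rewrite Cmod_mult. lra.
Qed.

(** * Termwise complex differentiation *)

Definition cderiv (a : nat -> C) (n : nat) : C := (RtoC (INR (S n)) * a (S n))%C.

Lemma cdisk_summable_deriv (a : nat -> C) :
  cdisk_summable a -> cdisk_summable (cderiv a).
Proof.
  intros H. apply cdisk_summable_shift with (a := fun n => (RtoC (INR n) * a n)%C).
  now apply cdisk_summable_mul_INR.
Qed.

(** Induction on [E (n+1) = (z + k) * E n + (n + 2) * z ^ (n + 1) * k ^ 2]. The constant is twice
    Taylor's: it is the multiplier of the second derived series, so the bounds can be summed. *)
Lemma cpow_remainder (z k : C) (rho : R) (n : nat) :
  Cmod z <= rho -> Cmod (z + k) <= rho ->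
  Cmod ((z + k) ^ (S (S n)) - z ^ (S (S n)) - RtoC (INR (S (S n))) * z ^ (S n) * k)%C
  <= INR (S (S n)) * INR (S n) * rho ^ n * Cmod k ^ 2.
Proof.
  intros Hz Hzk. assert (Hr := Rle_trans _ _ _ (Cmod_ge_0 z) Hz).
  induction n as [|n IH].
  - replace ((z + k) ^ 2 - z ^ 2 - INR 2 * z ^ 1 * k)%C with (k ^ 2)%C.
    + rewrite Cmod_pow. change (INR 2) with (1 + 1). change (INR 1) with 1. simpl (rho ^ 0).
      generalize (pow2_ge_0 (Cmod k)); lra.
    + change (INR 2) with (1 + 1). rewrite RtoC_plus. simpl. ring.
  - set (E := ((z + k) ^ S (S n) - z ^ S (S n) - INR (S (S n)) * z ^ S n * k)%C) in *.
    replace ((z + k) ^ S (S (S n)) - z ^ S (S (S n))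
             - INR (S (S (S n))) * z ^ S (S n) * k)%C
      with ((z + k) * E + RtoC (INR (S (S n))) * z ^ (S n) * k ^ 2)%C.
    2:{ unfold E. rewrite (S_INR (S (S n))), RtoC_plus. simpl. ring. }
    eapply Rle_trans; [apply Cmod_triangle|].
    rewrite !Cmod_mult, !Cmod_pow, Cmod_R, Rabs_right by (apply Rle_ge, pos_INR).
    assert (A : Cmod (z + k) * Cmod E
                <= rho * (INR (S (S n)) * INR (S n) * rho ^ n * Cmod k ^ 2))
      by (apply Rmult_le_compat; auto using Cmod_ge_0).
    assert (B : INR (S (S n)) * Cmod z ^ S n * Cmod k ^ 2
                <= INR (S (S n)) * rho ^ S n * Cmod k ^ 2).
    { apply Rmult_le_compat_r; [apply pow2_ge_0|].
      apply Rmult_le_compat_l; [apply pos_INR|].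
      apply pow_incr; split; [apply Cmod_ge_0 | auto]. }
    assert (0 <= INR (S (S n)) * rho ^ S n * Cmod k ^ 2).
    { apply Rmult_le_pos; [|apply pow2_ge_0].
      apply Rmult_le_pos; [apply pos_INR|now apply pow_le]. }
    rewrite (S_INR (S (S n))), (S_INR (S n)) in *. simpl (rho ^ S n) in *. nra.
Qed.

Lemma is_cseries_incr_1 (u : nat -> C) (l : C) :
  is_cseries u l -> is_cseries (fun n => u (S n)) (l - u 0%nat)%C.
Proof.
  intros H. apply (@is_series_incr_1 C_AbsRing C_NormedModule).
  change (is_cseries u (l - u 0%nat + u 0%nat)%C).
  now replace (l - u 0%nat + u 0%nat)%C with l by ring.
Qed.

Lemma is_cseries_decr_1 (u : nat -> C) (l : C) :
  is_cseries (fun n => u (S n)) l -> is_cseries u (l + u 0%nat)%C.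
Proof.
  intros H. apply (@is_series_decr_1 C_AbsRing C_NormedModule).
  change (is_cseries (fun n => u (S n)) (l + u 0%nat + - u 0%nat)%C).
  now replace (l + u 0%nat + - u 0%nat)%C with l by ring.
Qed.

Lemma is_derive_quadratic (f : C -> C) (z l : C) (M delta : R) :
  0 < delta ->
  (forall k, Cmod k < delta -> Cmod (f (z + k) - f z - l * k)%C <= M * Cmod k ^ 2) ->
  @is_derive C_AbsRing C_NormedModule f z l.
Proof.
  intros Hd H. split; [apply is_linear_scal_l|].
  intros x Hx.
  apply (@is_filter_lim_locally_unique C_AbsRing (AbsRing_NormedModule C_AbsRing)) in Hx. subst x.
  intros eps.
  assert (HM : 0 < Rmax M 1) by (generalize (Rmax_r M 1); lra).
  assert (He : 0 < eps / Rmax M 1) by (apply Rdiv_lt_0_compat; [apply cond_pos|auto]).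
  exists (mkposreal (Rmin delta (eps / Rmax M 1)) (Rmin_pos _ _ Hd He)).
  intros y Hy. change (Cmod (y - z)%C < Rmin delta (eps / Rmax M 1)) in Hy.
  change (Cmod (f y - f z - (y - z) * l)%C <= eps * Cmod (y - z)%C).
  specialize (H (y - z)%C (Rlt_le_trans _ _ _ Hy (Rmin_l _ _))).
  change C in y.
  replace (z + (y - z))%C with y in H by ring.
  replace (f y - f z - (y - z) * l)%C with (f y - f z - l * (y - z))%C by ring.
  set (k := Cmod (y - z)%C) in *. assert (Hk : 0 <= k) by apply Cmod_ge_0.
  apply Rle_trans with (1 := H).
  assert (k < eps / Rmax M 1) by (eapply Rlt_le_trans; [apply Hy|apply Rmin_r]).
  assert (Rmax M 1 * k <= eps).
  { apply Rmult_lt_compat_l with (r := Rmax M 1) in H0; auto.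
    replace (Rmax M 1 * (eps / Rmax M 1)) with (pos eps) in H0 by (field; lra). lra. }
  assert (M * k <= Rmax M 1 * k) by (apply Rmult_le_compat_r; auto; apply Rmax_l).
  nra.
Qed.

(** The remainder is quadratic in [k], with constant the majorant of the second derived series at
    [rho], halfway between [Cmod z] and 1; for [Cmod k < (1 - Cmod z) / 2] the point [z + k] stays
    in that disk. *)
Lemma is_derive_cps (a : nat -> C) (z : C) :
  cdisk_summable a -> Cmod z < 1 ->
  @is_derive C_AbsRing C_NormedModule (cps a) z (cps (cderiv a) z).
Proof.
  intros Ha Hz. set (rho := (Cmod z + 1) / 2).
  assert (P := Cmod_ge_0 z). assert (Hrho : 0 <= rho < 1) by (unfold rho; lra).
  assert (Hs : ex_series (fun n => INR (S (S n)) * INR (S n) * Cmod (a (S (S n))) * rho ^ n)).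
  { apply ex_Rseries_ext with (2 := cdisk_summable_ex _ _
      (cdisk_summable_deriv _ (cdisk_summable_deriv a Ha)) Hrho).
    intros n. unfold cderiv. rewrite !Cmod_mult, !Cmod_R.
    rewrite !Rabs_right by (apply Rle_ge, pos_INR). ring. }
  destruct Hs as [M HM].
  apply is_derive_quadratic with M ((1 - Cmod z) / 2); [lra|].
  intros k Hk.
  assert (Hzk : Cmod (z + k) <= rho).
  { eapply Rle_trans; [apply Cmod_triangle|]. unfold rho; lra. }
  assert (Hu := cps_correct a _ Ha (Rle_lt_trans _ _ _ Hzk (proj2 Hrho))).
  assert (Hv := cps_correct a z Ha Hz).
  assert (Hd := cps_correct _ z (cdisk_summable_deriv a Ha) Hz).
  apply (is_cseries_scal k) in Hd.
  (* The terms of degree 0 and 1 of the remainder vanish; removing one index before and one after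
     subtracting the derivative aligns the two series and leaves exponents [n + 2]. *)
  apply (is_cseries_minus _ _ _ _ Hu) in Hv. apply is_cseries_incr_1 in Hv.
  apply (is_cseries_minus _ _ _ _ Hv) in Hd. apply is_cseries_incr_1 in Hd.
  assert (Hd' : is_cseries (fun n => a (S (S n)) *
     ((z + k) ^ (S (S n)) - z ^ (S (S n)) - RtoC (INR (S (S n))) * z ^ (S n) * k))%C
     (cps a (z + k) - cps a z - cps (cderiv a) z * k)%C).
  { match type of Hd with is_series _ ?l => replace (cps a (z + k) - cps a z - cps (cderiv a) z * k)%C with l end.
    - apply is_cseries_ext with (2 := Hd). intros n. unfold cderiv. ring.
    - unfold cderiv at 2. simpl. ring. }
  clear Hd Hu Hv.
  rewrite Rmult_comm.
  assert (HM' := is_Rseries_scal (Cmod k ^ 2) _ _ HM).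
  assert (HN : ex_series (fun n => Cmod (a (S (S n)) *
     ((z + k) ^ (S (S n)) - z ^ (S (S n)) - RtoC (INR (S (S n))) * z ^ (S n) * k))%C)).
  { apply ex_Rseries_le with (2 := ex_intro _ _ HM').
    intros n.
    rewrite Rabs_right by (apply Rle_ge, Cmod_ge_0).
    rewrite Cmod_mult. assert (A := cpow_remainder z k rho n ltac:(unfold rho; lra) Hzk).
    apply Rmult_le_compat_l with (r := Cmod (a (S (S n)))) in A; [|apply Cmod_ge_0].
    eapply Rle_trans; [apply A|]. right. ring. }
  destruct HN as [N HN].
  apply Rle_trans with N; [apply (Cmod_is_cseries_le _ _ _ Hd' HN)|].
  rewrite <- (is_series_unique _ _ HN).
  rewrite <- (is_series_unique _ _ HM').
  apply Series_le; [|eexists; apply HM'].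
  intros n; split; [apply Cmod_ge_0|].
  rewrite Cmod_mult. assert (A := cpow_remainder z k rho n ltac:(unfold rho; lra) Hzk).
  apply Rmult_le_compat_l with (r := Cmod (a (S (S n)))) in A; [|apply Cmod_ge_0].
  eapply Rle_trans; [apply A|]. right. ring.
Qed.

Lemma locally_unit_disk (z : C) :
  Cmod z < 1 -> @locally (AbsRing_UniformSpace C_AbsRing) z (fun y => Cmod y < 1).
Proof.
  intros Hz. exists (mkposreal (1 - Cmod z) ltac:(lra)). intros y Hy.
  change (Cmod (y - z)%C < 1 - Cmod z) in Hy.
  change C in y. replace y with (z + (y - z))%C by ring.
  eapply Rle_lt_trans; [apply Cmod_triangle|]. lra.
Qed.

Lemma is_derive_of_power_series (h : C -> C) (a : nat -> C) :
  cdisk_summable a -> (forall z, Cmod z < 1 -> h z = cps a z) ->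
  forall z, Cmod z < 1 -> @is_derive C_AbsRing C_NormedModule h z (cps (cderiv a) z).
Proof.
  intros Ha Hh z Hz. apply is_derive_ext_loc with (cps a).
  - destruct (locally_unit_disk z Hz) as [d Hd]. exists d. intros y Hy.
    symmetry. apply Hh, Hd, Hy.
  - now apply is_derive_cps.
Qed.

Lemma C_derive_of_power_series (h : C -> C) (a : nat -> C) :
  cdisk_summable a -> (forall z, Cmod z < 1 -> h z = cps a z) ->
  forall z, Cmod z < 1 -> C_derive h z = cps (cderiv a) z.
Proof.
  intros Ha Hh z Hz. apply is_C_derive_unique. now apply is_derive_of_power_series.
Qed.

(** * Analytic functions with positive real part *)

Lemma le_of_left_limit (g : R -> R) (x0 x B : R) :
  x0 < x -> continuity_pt g x -> (forall y, x0 < y < x -> g y <= B) -> g x <= B.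
Proof.
  intros Hx Hg H. apply Rnot_lt_le. intros Hlt.
  destruct (Hg (g x - B) ltac:(lra)) as (d & Hd & HH).
  set (y := x - Rmin (d / 2) ((x - x0) / 2)).
  assert (0 < Rmin (d / 2) ((x - x0) / 2)) by (apply Rmin_pos; lra).
  assert (Rmin (d / 2) ((x - x0) / 2) <= d / 2) by apply Rmin_l.
  assert (Rmin (d / 2) ((x - x0) / 2) <= (x - x0) / 2) by apply Rmin_r.
  assert (Hy : x0 < y < x) by (unfold y; lra).
  specialize (H y Hy).
  assert (K : R_dist (g y) (g x) < g x - B).
  { apply HH. split; [split; [exact I|lra]|].
    unfold dist; simpl; unfold R_dist. rewrite Rabs_left by lra. unfold y; lra. }
  unfold R_dist in K. apply Rabs_def2 in K. lra.
Qed.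

Ltac Rring := match goal with |- @eq _ ?a ?b => change (@eq R a b); ring end.

Lemma sum_n_Sn_R (u : nat -> R) (n : nat) : sum_n u (S n) = sum_n u n + u (S n).
Proof. exact (@sum_Sn R_AbelianMonoid u n). Qed.

Lemma sum_n_le_is_series (D : nat -> R) (l : R) (N : nat) :
  (forall n, 0 <= D n) -> is_series D l -> sum_n D N <= l.
Proof.
  intros HD Hl.
  apply (is_lim_seq_incr_compare (fun n => sum_n D n) l Hl).
  intros n. rewrite sum_n_Sn_R. generalize (HD (S n)). lra.
Qed.

(** * Moments of trigonometric kernels *)

Definition cis (t : R) : C := (cos t, sin t).

Lemma cis_plus (s t : R) : cis (s + t) = (cis s * cis t)%C.
Proof.
  unfold cis, Cmult; simpl. rewrite cos_plus, sin_plus. f_equal; ring.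
Qed.

Lemma cis_pow (t : R) (n : nat) : (cis t ^ n)%C = cis (INR n * t).
Proof.
  induction n as [|n IH].
  - simpl INR. rewrite Rmult_0_l. unfold cis. now rewrite cos_0, sin_0.
  - rewrite Cpow_S, IH, <- cis_plus, S_INR. f_equal; ring.
Qed.

Lemma Cmod_cis (t : R) : Cmod (cis t) = 1.
Proof.
  unfold Cmod, cis; simpl fst; simpl snd.
  replace (cos t ^ 2 + sin t ^ 2) with 1; [apply sqrt_1|].
  generalize (sin2_cos2 t). unfold Rsqr. intros H; rewrite <- H. ring.
Qed.

(** Orthogonality of the characters. The frequency is an integer because pairing [cis t ^ n] with a
    conjugate power produces the difference [n - m]. *)
Lemma is_RInt_trigonometric (j : Z) (A B : R) :
  is_RInt (fun t => A * cos (IZR j * t) + B * sin (IZR j * t)) 0 (2 * PI)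
    (if Z.eq_dec j 0 then 2 * PI * A else 0).
Proof.
  destruct (Z.eq_dec j 0) as [E|E].
  - subst j. replace (2 * PI * A) with (scal (2 * PI - 0) A)
      by (unfold scal; simpl; unfold mult; simpl; ring).
    apply is_RInt_ext with (fun _ => A); [|apply (@is_RInt_const R_NormedModule)].
    intros t _. simpl. rewrite Rmult_0_l, cos_0, sin_0. ring.
  - assert (Hj : IZR j <> 0) by (now apply not_0_IZR).
    set (F := fun t => (A * sin (IZR j * t) - B * cos (IZR j * t)) / IZR j).
    replace 0 with (minus (F (2 * PI)) (F 0)) at 2.
    + apply (@is_RInt_derive R_CompleteNormedModule).
      * intros t _. unfold F. auto_derive; auto. field; auto.
      * intros t _.
        apply (ex_derive_continuous (fun t => A * cos (IZR j * t) + B * sin (IZR j * t))).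
        auto_derive; auto.
    + assert (HS : forall k : nat, cos (INR k * (2 * PI)) = 1 /\ sin (INR k * (2 * PI)) = 0).
      { intros k. replace (INR k * (2 * PI)) with (0 + 2 * INR k * PI) by ring.
        now rewrite cos_period, sin_period, cos_0, sin_0. }
      assert (HZ : cos (IZR j * (2 * PI)) = 1 /\ sin (IZR j * (2 * PI)) = 0).
      { destruct (ZArith_dec.Z_le_gt_dec 0 j) as [P|P].
        - specialize (HS (Z.to_nat j)). now rewrite INR_IZR_INZ, Z2Nat.id in HS by lia.
        - specialize (HS (Z.to_nat (- j))).
          rewrite INR_IZR_INZ, Z2Nat.id, opp_IZR in HS by lia.
          replace (- IZR j * (2 * PI)) with (- (IZR j * (2 * PI))) in HS by ring.
          rewrite cos_neg, sin_neg in HS. split; [tauto|]. destruct HS; lra. }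
      unfold minus, plus, opp, F; simpl. destruct HZ as [-> ->].
      replace (IZR j * 0) with 0 by ring. rewrite cos_0, sin_0. field; auto.
Qed.

(** [kappa n] is the mean of [cis t ^ n * K t] over a period. Quantifying over the factor [q]
    expresses this complex integral by real ones. *)
Definition moments (K : R -> R) (kappa : nat -> C) : Prop :=
  forall (n : nat) (q : C),
    is_RInt (fun t => Re (q * cis t ^ n) * K t) 0 (2 * PI) (2 * PI * Re (q * kappa n)).

Lemma moments_const (c : R) :
  moments (fun _ => c) (fun n => match n with O => RtoC c | S _ => RtoC 0 end).
Proof.
  intros n q.
  assert (H := is_RInt_trigonometric (Z.of_nat n) (c * Re q) (- (c * Im q))).
  apply is_RInt_ext with (g := fun t => Re (q * cis t ^ n) * c) in H.
  - destruct (Z.eq_dec (Z.of_nat n) 0) as [E|E]; destruct n; try lia;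
      (match type of H with is_RInt _ _ _ ?a =>
         match goal with |- is_RInt _ _ _ ?b => replace b with a; [exact H|] end end).
    + rewrite re_scal_r. ring.
    + rewrite re_scal_r. ring.
  - intros t _. rewrite cis_pow, <- INR_IZR_INZ, re_mult. unfold cis; simpl. ring.
Qed.

Lemma moments_plus (K L : R -> R) (k l : nat -> C) :
  moments K k -> moments L l -> moments (fun t => K t + L t) (fun n => k n + l n)%C.
Proof.
  intros HK HL n q.
  assert (H := @is_RInt_plus R_NormedModule _ _ _ _ _ _ (HK n q) (HL n q)).
  apply is_RInt_ext with (g := fun t => Re (q * cis t ^ n) * (K t + L t)) in H.
  - match type of H with is_RInt _ _ _ ?a =>
         match goal with |- is_RInt _ _ _ ?b => replace b with a; [exact H|] end end.
    rewrite Cmult_plus_distr_l, re_plus. unfold plus; simpl. ring.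
  - intros t _. unfold plus; simpl. ring.
Qed.

Lemma moments_ext (K L : R -> R) (k l : nat -> C) :
  (forall t, K t = L t) -> (forall n, k n = l n) -> moments K k -> moments L l.
Proof.
  intros HK Hk H n q. rewrite <- Hk. apply is_RInt_ext with (2 := H n q).
  intros t _. now rewrite HK.
Qed.

(** The kernel is a monomial plus its conjugate, with frequencies [n - m] and [n + m] after pairing;
    as [0 < m], the second one never vanishes and the conjugate contributes nothing. *)
Lemma moments_monomial (m : nat) (k : C) :
  (0 < m)%nat ->
  moments (fun t => 2 * Re (k * cis (- t) ^ m))
    (fun n => if Nat.eq_dec n m then k else RtoC 0).
Proof.
  intros Hm n q.
  assert (H1 := is_RInt_trigonometric (Z.of_nat n - Z.of_nat m) (Re (q * k)) (- Im (q * k))).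
  assert (H2 := is_RInt_trigonometric (Z.of_nat n + Z.of_nat m)
                  (Re (q * Cconj k)) (- Im (q * Cconj k))).
  assert (H := @is_RInt_plus R_NormedModule _ _ _ _ _ _ H1 H2).
  apply is_RInt_ext with (g := fun t => Re (q * cis t ^ n) * (2 * Re (k * cis (- t) ^ m))) in H.
  - match type of H with is_RInt _ _ _ ?a =>
         match goal with |- is_RInt _ _ _ ?b => replace b with a; [exact H|] end end.
    destruct (Z.eq_dec (Z.of_nat n + Z.of_nat m) 0); [lia|].
    destruct (Z.eq_dec (Z.of_nat n - Z.of_nat m) 0); destruct (Nat.eq_dec n m); try lia;
      unfold plus; simpl; ring.
  - intros t _. rewrite !cis_pow, minus_IZR, plus_IZR, <- !INR_IZR_INZ.
    unfold plus; simpl.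
    replace ((INR n - INR m) * t) with (INR n * t - INR m * t) by ring.
    replace ((INR n + INR m) * t) with (INR n * t + INR m * t) by ring.
    replace (INR m * - t) with (- (INR m * t)) by ring.
    rewrite cos_minus, sin_minus, cos_plus, sin_plus.
    unfold cis. rewrite cos_neg, sin_neg. destruct q, k; simpl. ring.
Qed.

Lemma moments_pairing (K : R -> R) (kappa q : nat -> C) (T : nat) :
  moments K kappa ->
  is_RInt (fun t => sum_n (fun n => Re (q n * cis t ^ n)) T * K t) 0 (2 * PI)
    (2 * PI * sum_n (fun n => Re (q n * kappa n)) T).
Proof.
  intros HK. induction T as [|T IH].
  - rewrite sum_O. apply is_RInt_ext with (2 := HK 0%nat (q 0%nat)).
    intros t _. now rewrite sum_O.
  - rewrite sum_Sn.
    assert (H := @is_RInt_plus R_NormedModule _ _ _ _ _ _ IH (HK (S T) (q (S T)))).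
    apply is_RInt_ext with
      (g := fun t => sum_n (fun n => Re (q n * cis t ^ n)) (S T) * K t) in H.
    + match type of H with is_RInt _ _ _ ?a =>
         match goal with |- is_RInt _ _ _ ?b => replace b with a; [exact H|] end end.
      unfold plus; simpl. ring.
    + intros t _. rewrite sum_n_Sn_R. unfold plus; simpl (_ ^ _)%C. simpl. ring.
Qed.

Lemma sum_n_stationary (u : nat -> R) (M T : nat) :
  (M <= T)%nat -> (forall n, (M < n <= T)%nat -> u n = 0) -> sum_n u T = sum_n u M.
Proof.
  intros HT. induction HT as [|T HT IH]; auto. intros Hu.
  rewrite sum_n_Sn_R, IH, Hu; [apply Rplus_0_r | lia | intros n Hn; apply Hu; lia].
Qed.

(** The sum is the mean of a nonnegative function times [K]. If it were some [X < 0], a partial sum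
    of the function would be at least [- d] everywhere; adding [d] makes the integrand nonnegative
    and changes the mean by [d * Re (kappa 0)] only, too little to compensate [X]. *)
Lemma positive_pairing (K : R -> R) (kappa q : nat -> C) (M : nat) :
  (forall t, 0 <= K t) -> moments K kappa ->
  (forall n, (M < n)%nat -> kappa n = RtoC 0) ->
  ex_series (fun n => Cmod (q n)) ->
  (forall t, 0 <= Re (csum (fun n => q n * cis t ^ n)%C)) ->
  0 <= sum_n (fun n => Re (q n * kappa n)) M.
Proof.
  intros HK Hm Hkappa [L HL] Hq. change R in L. apply Rnot_lt_le. intros Hneg.
  set (X := (sum_n (fun n => Re (q n * kappa n)) M : R)) in *.
  (* Chosen so that [d * Re (kappa 0)] stays below half of [- X]; the [+ 1] keeps the denominator
     positive. *)
  set (d := - X / (2 * (Rabs (Re (kappa 0%nat)) + 1))).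
  assert (HP := Rabs_pos (Re (kappa 0%nat))).
  assert (Hd : 0 < d) by (apply Rdiv_lt_0_compat; lra).
  assert (HN := proj2 (is_lim_seq_spec (sum_n (fun n => Cmod (q n))) (Finite L)) HL
                  (mkposreal d Hd)).
  destruct HN as [N HN]. set (T := max M N).
  specialize (HN T ltac:(unfold T; lia)). simpl in HN.
  apply Rabs_def2 in HN.
  assert (Hlow : forall t, - d <= sum_n (fun n => Re (q n * cis t ^ n)) T).
  { intros t.
    assert (HC : is_cseries (fun n => q n * cis t ^ n)%C (csum (fun n => q n * cis t ^ n)%C)).
    { apply csum_correct. exists L. apply is_Rseries_ext with (2 := HL).
      intros n. rewrite Cmod_mult, Cmod_pow, Cmod_cis, pow1. ring. }
    apply is_cseries_iff in HC as [HC _].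
    (* The terms [Cmod (q n) - Re (q n * cis t ^ n)] are nonnegative, so their partial sums stay
       below the total: truncation costs the real parts at most the tail of the moduli, less than
       [d]. *)
    assert (HD := is_Rseries_minus _ _ _ _ HL HC).
    apply sum_n_le_is_series with (N := T) in HD.
    - specialize (Hq t).
      replace (sum_n (fun n => Cmod (q n) - Re (q n * cis t ^ n)) T) with
        (sum_n (fun n => Cmod (q n)) T - sum_n (fun n => Re (q n * cis t ^ n)) T) in HD.
      + lra.
      + clear. induction T as [|T IH]; [now rewrite !sum_O|].
        rewrite !sum_n_Sn_R, <- IH. ring.
    - intros n. assert (A := Re_le_Cmod (q n * cis t ^ n)).
      rewrite Cmod_mult, Cmod_pow, Cmod_cis, pow1 in A. lra. }
  assert (HI := moments_pairing K kappa q T Hm).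
  rewrite (sum_n_stationary _ M T) in HI.
  2: unfold T; lia.
  2: { intros n Hn. rewrite Hkappa by lia. rewrite Cmult_0_r. apply re_RtoC. }
  fold X in HI.
  assert (HJ := @is_RInt_plus R_NormedModule _ _ _ _ _ _ HI (Hm 0%nat (RtoC d))).
  apply is_RInt_ge_0 in HJ.
  - unfold plus in HJ; simpl in HJ.
    change (0 <= 2 * PI * X + 2 * PI * Re (d * kappa 0%nat)) in HJ.
    rewrite re_scal_l in HJ. assert (PP := PI_RGT_0).
    assert (0 <= X + d * Re (kappa 0%nat)) by nra.
    assert (A := Rle_abs (Re (kappa 0%nat))).
    assert (E : d * (2 * (Rabs (Re (kappa 0%nat)) + 1)) = - X) by (unfold d; field; lra).
    nra.
  - generalize PI_RGT_0; lra.
  - intros t _. unfold plus; simpl (Cpow _ 0).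
    change (0 <= sum_n (fun n => Re (q n * cis t ^ n)) T * K t + Re (d * 1) * K t).
    rewrite re_scal_l, re_RtoC. generalize (Hlow t) (HK t). nra.
Qed.

(** The dilated function [z => cps q (rho z)] has an absolutely convergent series on the unit
    circle, as [positive_pairing] requires. *)
Lemma scaled_positive (q : nat -> C) (rho : R) :
  cdisk_summable q -> (forall z, Cmod z < 1 -> 0 <= Re (cps q z)) -> 0 < rho < 1 ->
  ex_series (fun n => Cmod (q n * RtoC (rho ^ n))%C) /\
  forall t, 0 <= Re (csum (fun n => (q n * RtoC (rho ^ n)) * cis t ^ n)%C).
Proof.
  intros Hq Hpos Hrho. split.
  - apply ex_Rseries_ext with (2 := cdisk_summable_ex q rho Hq ltac:(lra)).
    intros n. rewrite Cmod_mult, Cmod_R, Rabs_right; auto. apply Rle_ge, pow_le; lra.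
  - intros t. specialize (Hpos (RtoC rho * cis t)%C).
    rewrite Cmod_mult, Cmod_R, Cmod_cis, Rabs_right in Hpos by lra.
    specialize (Hpos ltac:(lra)). unfold cps in Hpos.
    rewrite (csum_ext _ (fun n => q n * (RtoC rho * cis t) ^ n)%C); [exact Hpos|]. intros n.
    rewrite Cpow_mult_l, <- RtoC_pow. ring.
Qed.

(** * The inequalities of Caratheodory and Harnack *)

(** Pair the dilated coefficients with the kernel [1 - Re (c * cis (- t) ^ (m + 1)) >= 0], where [c]
    rotates [q (S m)] onto its modulus. The pairing is [1 - Cmod (q (S m)) * rho ^ (m + 1) / 2], and
    [rho] tends to 1. *)
Lemma caratheodory (q : nat -> C) (m : nat) :
  cdisk_summable q -> q 0%nat = RtoC 1 ->
  (forall z, Cmod z < 1 -> 0 <= Re (cps q z)) ->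
  Cmod (q (S m)) <= 2.
Proof.
  intros Hq Hq0 Hpos.
  replace (Cmod (q (S m))) with (Cmod (q (S m)) * 1 ^ S m) by (rewrite pow1; ring).
  apply (le_of_left_limit (fun rho => Cmod (q (S m)) * rho ^ S m) 0 1); [lra| |].
  { apply continuity_pt_mult; [apply continuity_pt_const; now intros ? ?|].
    apply derivable_continuous_pt, derivable_pt_pow. }
  intros rho Hrho.
  destruct (scaled_positive q rho Hq Hpos Hrho) as [H1 H2].
  destruct (Cmod_unimodular (q (S m))) as (c & Hc & E).
  set (k := (RtoC (- (1 / 2)) * c)%C).
  assert (Hm := moments_plus _ _ _ _ (moments_const 1) (moments_monomial (S m) k ltac:(lia))).
  assert (Hk : Cmod k = 1 / 2).
  { unfold k. rewrite Cmod_mult, Cmod_R, Hc, Rabs_left by lra. lra. }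
  assert (HK : forall t, 0 <= 1 + 2 * Re (k * cis (- t) ^ S m)).
  { intros t. assert (A := re_le_Cmod (k * cis (- t) ^ S m)).
    rewrite Cmod_mult, Cmod_pow, Cmod_cis, pow1, Hk in A.
    apply Rabs_le_between in A. lra. }
  assert (Hsupp : forall n, (S m < n)%nat ->
    (match n with O => RtoC 1 | S _ => RtoC 0 end
     + (if Nat.eq_dec n (S m) then k else RtoC 0))%C = RtoC 0).
  { intros n Hn. destruct n; [lia|]. destruct (Nat.eq_dec (S n) (S m)); [lia|].
    apply Cplus_0_l. }
  assert (P := positive_pairing _ _ _ (S m) HK Hm Hsupp H1 H2). cbv beta in P.
  rewrite sum_n_Sn_R in P.
  replace (sum_n _ m) with 1 in P.
  - destruct (Nat.eq_dec (S m) (S m)); [|lia].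
    rewrite Cplus_0_l in P.
    replace (q (S m) * RtoC (rho ^ S m) * k)%C
      with (RtoC (- (1 / 2) * rho ^ S m) * (c * q (S m)))%C in P
      by (unfold k; rewrite RtoC_mult; ring).
    rewrite E, <- RtoC_mult, re_RtoC in P. lra.
  - clear - Hq0. symmetry. rewrite (sum_n_stationary _ 0 m).
    + rewrite sum_O. destruct (Nat.eq_dec 0 (S m)); [lia|]. rewrite Hq0.
      simpl. ring.
    + lia.
    + intros n Hn. destruct n; [lia|]. destruct (Nat.eq_dec (S n) (S m)); [lia|].
      rewrite Cplus_0_l, Cmult_0_r. apply re_RtoC.
Qed.

(** Terms of the Poisson kernel [Re ((1 + w) / (1 - w)) = 1 + 2 * sum Re (w ^ m)]. *)
Definition poisson_term (w : C) (m : nat) : R :=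
  match m with O => 1 | S _ => 2 * Re (w ^ m) end.

(** With [G] the geometric sum, [2 G - 1 = (1 + w) / (1 - w) - 2 w ^ (M + 1) / (1 - w)]. The first
    real part is [(1 - s ^ 2) / Cmod (1 - w) ^ 2], and [1 - s <= Cmod (1 - w) <= 1 + s] bounds both
    parts. *)
Lemma poisson_sum_lower (w : C) (M : nat) :
  Cmod w < 1 ->
  (1 - Cmod w) / (1 + Cmod w) - 2 * Cmod w ^ S M / (1 - Cmod w)
  <= sum_n (poisson_term w) M.
Proof.
  intros Hw. set (s := Cmod w) in *. assert (Hs : 0 <= s) by apply Cmod_ge_0.
  set (d := (1 - w)%C).
  assert (Hsum : exists G : C, (d * G = 1 - w ^ S M)%C /\
            sum_n (poisson_term w) M = 2 * Re G - 1).
  { unfold d. induction M as [|M [G [HG HE]]].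
    - exists (RtoC 1). split; [simpl; ring|]. rewrite sum_O. simpl. Rring.
    - exists (G + w ^ S M)%C. split.
      + rewrite Cmult_plus_distr_l, HG. simpl. ring.
      + rewrite sum_n_Sn_R, HE, re_plus. unfold poisson_term. Rring. }
  destruct Hsum as (G & HG & ->).
  assert (Hd1 : 1 - s <= Cmod d).
  { assert (A := Cmod_triangle d w). replace (d + w)%C with (RtoC 1) in A by (unfold d; ring).
    rewrite Cmod_1 in A. unfold s; lra. }
  assert (Hd2 : Cmod d <= 1 + s).
  { unfold d, Cminus. eapply Rle_trans; [apply Cmod_triangle|].
    rewrite Cmod_1, Cmod_opp. unfold s; lra. }
  assert (Hd0 : d <> RtoC 0) by (intros E; rewrite E, Cmod_0 in Hd1; lra).
  assert (EG : G = ((1 - w ^ S M) / d)%C).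
  { rewrite <- HG. field; auto. }
  assert (E : (RtoC 2 * G - 1 = RtoC (/ (Cmod d ^ 2)) * ((1 + w) * Cconj d)
                - RtoC 2 * (w ^ S M / d))%C).
  { rewrite EG. rewrite RtoC_inv by (apply pow_nonzero; lra). rewrite Cmod2_conj.
    assert (Cconj d <> RtoC 0).
    { intros F. apply Hd0. rewrite <- (Cconj_conj d), F. unfold Cconj, RtoC; simpl.
      now rewrite Ropp_0. }
    field_simplify_eq; auto. unfold d. ring. }
  replace (2 * Re G - 1) with (Re (RtoC 2 * G - 1)%C)
    by (unfold Cminus; rewrite re_plus, re_scal_l, re_opp, re_RtoC; ring).
  rewrite E. unfold Cminus. rewrite re_plus, re_opp, !re_scal_l.
  assert (A : Re (w ^ S M / d) <= s ^ S M / (1 - s)).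
  { eapply Rle_trans; [apply Re_le_Cmod|]. rewrite Cmod_div, Cmod_pow by auto.
    fold s. apply Rmult_le_compat_l; [now apply pow_le|].
    apply Rinv_le_contravar; lra. }
  assert (B : Re ((1 + w) * Cconj d) = 1 - s ^ 2).
  { unfold s. rewrite Cmod2_alt. unfold d. destruct w as [x y].
    unfold Cconj, Cmult, Cplus, Copp, RtoC; simpl. ring. }
  rewrite B.
  assert (D : (1 - s) / (1 + s) <= / Cmod d ^ 2 * (1 - s ^ 2)).
  { replace ((1 - s) / (1 + s)) with (/ (1 + s) ^ 2 * (1 - s ^ 2)) by (field; lra).
    apply Rmult_le_compat_r; [nra|]. apply Rinv_le_contravar.
    - apply pow_lt; lra.
    - apply pow_incr; lra. }
  unfold Rdiv in *. lra.
Qed.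

Lemma moments_poisson (k : C) (M : nat) :
  moments (fun t => sum_n (poisson_term (k * cis (- t))) M)
    (fun n => if le_dec n M then (k ^ n)%C else RtoC 0).
Proof.
  induction M as [|M IH].
  - apply moments_ext with (3 := moments_const 1).
    + intros t. now rewrite sum_O.
    + intros [|n]; destruct le_dec; try lia; auto.
  - apply moments_ext with (3 := moments_plus _ _ _ _ IH
      (moments_monomial (S M) (k ^ S M)%C ltac:(lia))).
    + intros t. rewrite sum_n_Sn_R.
      change (poisson_term (k * cis (- t)) (S M)) with (2 * Re ((k * cis (- t)) ^ S M)).
      now rewrite Cpow_mult_l.
    + intros n. destruct (le_dec n M), (le_dec n (S M)), (Nat.eq_dec n (S M)); try lia.
      * apply Cplus_0_r.
      * subst n. apply Cplus_0_l.
      * apply Cplus_0_l.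
Qed.

(** The kernel is the truncated Poisson kernel at [k = z / rho] minus its lower bound [c]. Since
    [rho ^ n * k ^ n = z ^ n], the dilation cancels, and the pairing is the partial sum at [z] minus
    [c]. *)
Lemma harnack_truncated (q : nat -> C) (z : C) (rho : R) (M : nat) :
  cdisk_summable q -> q 0%nat = RtoC 1 ->
  (forall z, Cmod z < 1 -> 0 <= Re (cps q z)) ->
  Cmod z < rho < 1 ->
  (rho - Cmod z) / (rho + Cmod z) - 2 * (Cmod z / rho) ^ S M / (1 - Cmod z / rho)
  <= sum_n (fun n => Re (q n * z ^ n)) M.
Proof.
  intros Hq Hq0 Hpos Hrho. assert (Hz := Cmod_ge_0 z).
  destruct (scaled_positive q rho Hq Hpos ltac:(lra)) as [H1 H2].
  set (k := (RtoC (/ rho) * z)%C).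
  assert (Hk : Cmod k = Cmod z / rho).
  { unfold k. rewrite Cmod_mult, Cmod_R, Rabs_right.
    - unfold Rdiv; ring.
    - apply Rle_ge, Rlt_le, Rinv_0_lt_compat; lra. }
  assert (Hk1 : Cmod z / rho < 1).
  { apply Rmult_lt_reg_r with rho; [lra|]. field_simplify; lra. }
  replace ((rho - Cmod z) / (rho + Cmod z)) with ((1 - Cmod k) / (1 + Cmod k))
    by (rewrite Hk; field; lra).
  rewrite <- Hk.
  set (c := (1 - Cmod k) / (1 + Cmod k) - 2 * Cmod k ^ S M / (1 - Cmod k)).
  assert (HK : forall t, 0 <= sum_n (poisson_term (k * cis (- t))) M + - c).
  { intros t. assert (A := poisson_sum_lower (k * cis (- t)) M).
    rewrite Cmod_mult, Cmod_cis, Rmult_1_r in A. fold c in A.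
    rewrite Hk in A. specialize (A Hk1). lra. }
  assert (Hm := moments_plus _ _ _ _ (moments_poisson k M) (moments_const (- c))).
  assert (Hsupp : forall n, (M < n)%nat ->
    ((if le_dec n M then (k ^ n)%C else RtoC 0)
     + match n with O => RtoC (- c) | S _ => RtoC 0 end)%C = RtoC 0).
  { intros [|n] Hn; [lia|]. destruct (le_dec (S n) M); [lia|]. apply Cplus_0_l. }
  assert (P := positive_pairing _ _ _ M HK Hm Hsupp H1 H2). cbv beta in P.
  assert (E : forall T, (T <= M)%nat -> sum_n (fun n => Re (q n * RtoC (rho ^ n) *
     ((if le_dec n M then (k ^ n)%C else RtoC 0)
       + match n with O => RtoC (- c) | S _ => RtoC 0 end))) T
     = sum_n (fun n => Re (q n * z ^ n)) T - c).
  { induction T as [|T IH]; intros HT.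
    - rewrite !sum_O. destruct (le_dec 0 M); [|lia]. rewrite Hq0. simpl. Rring.
    - rewrite !sum_n_Sn_R, IH by lia. destruct (le_dec (S T) M); [|lia].
      replace (q (S T) * (rho ^ S T)%R * (k ^ S T + 0))%C with (q (S T) * z ^ S T)%C.
      + Rring.
      + replace z with (RtoC rho * k)%C at 1.
        * rewrite Cpow_mult_l, <- RtoC_pow. ring.
        * unfold k. rewrite Cmult_assoc, <- RtoC_mult, Rinv_r by lra. ring. }
  rewrite E in P by lia. lra.
Qed.

(** For fixed [rho > Cmod z] the truncation error is geometric and disappears as [M] grows; the
    remaining bound is continuous in [rho] up to 1. *)
Lemma harnack (q : nat -> C) (z : C) :
  cdisk_summable q -> q 0%nat = RtoC 1 ->
  (forall z, Cmod z < 1 -> 0 <= Re (cps q z)) ->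
  Cmod z < 1 ->
  (1 - Cmod z) / (1 + Cmod z) <= Re (cps q z).
Proof.
  intros Hq Hq0 Hpos Hz1. assert (Hz := Cmod_ge_0 z).
  apply (le_of_left_limit (fun rho => (rho - Cmod z) / (rho + Cmod z)) (Cmod z) 1); auto.
  { apply derivable_continuous_pt. apply ex_derive_Reals_0. auto_derive. lra. }
  intros rho Hrho.
  assert (HC := cps_correct q z Hq Hz1). apply is_cseries_iff in HC as [HC _].
  set (s := Cmod z / rho).
  assert (Hs : 0 <= s < 1).
  { unfold s; split.
    - apply Rmult_le_pos; [auto|]. apply Rlt_le, Rinv_0_lt_compat; lra.
    - apply Rmult_lt_reg_r with rho; [lra|]. field_simplify; lra. }
  assert (L1 : is_lim_seq (fun M => (rho - Cmod z) / (rho + Cmod z) - 2 * s ^ S M / (1 - s))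
                 ((rho - Cmod z) / (rho + Cmod z))).
  { replace (Finite ((rho - Cmod z) / (rho + Cmod z)))
      with (Finite ((rho - Cmod z) / (rho + Cmod z) - 2 / (1 - s) * 0)) by (f_equal; ring).
    apply is_lim_seq_ext with (fun M => (rho - Cmod z) / (rho + Cmod z) - 2 / (1 - s) * s ^ S M).
    { intros n. field; lra. }
    apply is_lim_seq_minus'; [apply is_lim_seq_const|].
    apply (is_lim_seq_scal_l _ _ 0).
    apply -> (is_lim_seq_incr_1 (fun n => s ^ n)). apply is_lim_seq_geom.
    rewrite Rabs_right; lra. }
  exact (is_lim_seq_le _ _ _ (Finite _) (fun M => harnack_truncated q z rho M Hq Hq0 Hpos Hrho) L1 HC).
Qed.

(** * Inverting [u + alpha t u'] along radii *)

Lemma PSeries_mul_INR (d : nat -> R) (t : R) :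
  PSeries (fun n => INR n * d n) t = t * PSeries (PS_derive d) t.
Proof.
  rewrite <- PSeries_incr_1. apply PSeries_ext. intros [|n].
  - simpl. apply Rmult_0_l.
  - reflexivity.
Qed.

Lemma ex_pseries_disk (d : nat -> R) (t : R) :
  disk_summable d -> Rabs t < 1 -> ex_pseries d t.
Proof. intros; now apply CV_radius_inside, disk_summable_CV_radius. Qed.

Lemma PSeries_sub (a b : nat -> R) (x : R) :
  ex_pseries a x -> ex_pseries b x ->
  PSeries (fun n => a n - b n) x = PSeries a x - PSeries b x.
Proof. apply PSeries_minus. Qed.

Lemma PSeries_euler_operator (alpha : R) (d : nat -> R) (t : R) :
  disk_summable d -> Rabs t < 1 ->
  PSeries (fun n => (1 + alpha * INR n) * d n) t
  = PSeries d t + alpha * t * PSeries (PS_derive d) t.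
Proof.
  intros Hd Ht. rewrite Rmult_assoc, <- PSeries_mul_INR.
  change (alpha * PSeries (fun n => INR n * d n) t)
    with (scal alpha (PSeries (fun n => INR n * d n) t)).
  unfold scal; simpl; unfold mult; simpl. rewrite <- PSeries_scal, <- PSeries_plus.
  - apply PSeries_ext. intros n. unfold PS_plus, PS_scal, plus, scal; simpl.
    unfold mult; simpl. ring.
  - now apply ex_pseries_disk.
  - apply ex_pseries_scal; [apply Rmult_comm|].
    apply ex_pseries_disk; auto. now apply disk_summable_mul_INR.
Qed.

(* At a minimum point [m] of the sum [D] on [[0, rho]] one has [m * D' m <= 0], so
   the hypothesis [D m + alpha * m * D' m >= 0] forces [D m >= 0]. *)
Lemma euler_operator_positive (alpha rho : R) (d : nat -> R) :
  0 <= alpha -> 0 <= rho < 1 -> disk_summable d ->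
  (forall t, 0 <= t <= rho -> 0 <= PSeries (fun n => (1 + alpha * INR n) * d n) t) ->
  forall t, 0 <= t <= rho -> 0 <= PSeries d t.
Proof.
  intros Ha HR Hd H t Ht.
  assert (HA : forall x, 0 <= x <= rho -> Rabs x < 1)
    by (intros x Hx; rewrite Rabs_right; lra).
  destruct (continuity_ab_min (PSeries d) 0 rho ltac:(lra)) as (m & Hmin & Hm).
  { intros c Hc. apply PSeries_continuity, disk_summable_CV_radius; auto. }
  apply Rle_trans with (PSeries d m); [|now apply Hmin].
  specialize (H m Hm). rewrite PSeries_euler_operator in H by auto.
  assert (HD : m * PSeries (PS_derive d) m <= 0).
  { destruct (Req_dec m 0) as [E|E]; [rewrite E; lra|].
    assert (D : derivable_pt_lim (PSeries d) m (PSeries (PS_derive d) m)).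
    { apply is_derive_Reals, is_derive_PSeries, disk_summable_CV_radius; auto. }
    apply Rnot_lt_le. intros Hlt.
    assert (Hl : 0 < PSeries (PS_derive d) m) by nra.
    destruct (D _ Hl) as [delta HD]. assert (Hdelta := cond_pos delta).
    set (k := Rmin (delta / 2) m).
    assert (Hk : 0 < k) by (apply Rmin_pos; lra).
    assert (k <= delta / 2) by apply Rmin_l. assert (k <= m) by apply Rmin_r.
    specialize (HD (- k) ltac:(lra)). rewrite Rabs_Ropp, Rabs_right in HD by lra.
    specialize (HD ltac:(lra)). apply Rabs_def2 in HD as [_ HD].
    assert (HQ : 0 < (PSeries d (m + - k) - PSeries d m) / - k) by lra.
    assert (PSeries d m <= PSeries d (m + - k)) by (apply Hmin; lra).
    assert ((PSeries d (m + - k) - PSeries d m) / - k <= 0).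
    { unfold Rdiv.
      assert (0 < / k) by now apply Rinv_0_lt_compat.
      replace (/ - k) with (- / k) by (field; lra). nra. }
    lra. }
  assert (alpha * (m * PSeries (PS_derive d) m) <= 0) by nra. nra.
Qed.

Lemma PSeries_radial (a : nat -> C) (u : C) (t : R) :
  PSeries (fun n => Re (a n * u ^ n)) t = Re (cps a (RtoC t * u)).
Proof.
  transitivity (Series (fun n => Re (a n * (RtoC t * u) ^ n))); [|reflexivity].
  apply Series_ext. intros n.
  rewrite Cpow_mult_l, <- RtoC_pow.
  replace (a n * ((t ^ n)%R * u ^ n))%C with (a n * u ^ n * (t ^ n)%R)%C by ring.
  now rewrite re_scal_r.
Qed.

(** On the ray through [u] the real part of [cps a] is a real power series in [t];
    [euler_operator_positive] is applied to its difference with [c]. *)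
Lemma euler_operator_radial (alpha rho : R) (a : nat -> C) (c : nat -> R) (u : C) :
  0 <= alpha -> 0 <= rho < 1 -> Cmod u = 1 -> cdisk_summable a -> disk_summable c ->
  (forall t, 0 <= t <= rho ->
     PSeries (fun n => (1 + alpha * INR n) * c n) t
     <= Re (cps (fun n => RtoC (1 + alpha * INR n) * a n)%C (RtoC t * u))) ->
  forall t, 0 <= t <= rho -> PSeries c t <= Re (cps a (RtoC t * u)).
Proof.
  intros Hal HR Hu Ha Hc H t Ht.
  assert (HA : forall x, 0 <= x <= rho -> Rabs x < 1)
    by (intros x Hx; rewrite Rabs_right; lra).
  assert (Hau : disk_summable (fun n => Re (a n * u ^ n))).
  { apply disk_summable_le with (2 := Ha). intros n.
    rewrite (Rabs_right (Cmod _)) by apply Rle_ge, Cmod_ge_0.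
    eapply Rle_trans; [apply re_le_Cmod|]. rewrite Cmod_mult, Cmod_pow, Hu, pow1. lra. }
  assert (Heul : forall c, disk_summable c -> disk_summable (fun n => (1 + alpha * INR n) * c n)).
  { intros e He. apply disk_summable_le with (d := fun n => e n + alpha * (INR n * e n)).
    - intros n. right. f_equal. ring.
    - apply disk_summable_plus; auto. now apply disk_summable_scal, disk_summable_mul_INR. }
  assert (Hmc : disk_summable (fun n => -1 * c n)) by now apply disk_summable_scal.
  assert (P : forall x, 0 <= x <= rho ->
    0 <= PSeries (fun n => Re (a n * u ^ n) + -1 * c n) x).
  { apply euler_operator_positive with alpha; auto.
    - now apply disk_summable_plus.
    - intros x Hx. specialize (H x Hx). rewrite <- PSeries_radial in H.
      assert (E : PSeries (fun n => (1 + alpha * INR n) * (Re (a n * u ^ n) + -1 * c n)) x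
        = PSeries (fun n => Re (RtoC (1 + alpha * INR n) * a n * u ^ n)) x
          - PSeries (fun n => (1 + alpha * INR n) * c n) x).
      { rewrite <- PSeries_sub.
        - apply PSeries_ext. intros n.
          rewrite <- Cmult_assoc, re_scal_l. ring.
        - apply ex_pseries_ext with (fun n => (1 + alpha * INR n) * Re (a n * u ^ n)).
          + intros n. now rewrite <- Cmult_assoc, re_scal_l.
          + apply ex_pseries_disk; auto.
        - apply ex_pseries_disk; auto. }
      rewrite E. lra. }
  specialize (P t Ht). rewrite <- PSeries_radial.
  assert (E : PSeries (fun n => Re (a n * u ^ n) + -1 * c n) t
    = PSeries (fun n => Re (a n * u ^ n)) t - PSeries c t).
  { rewrite <- PSeries_sub by (apply ex_pseries_disk; auto).
    apply PSeries_ext. intros n. ring. }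
  lra.
Qed.

Lemma polar_form (z : C) : exists u : C, Cmod u = 1 /\ z = (RtoC (Cmod z) * u)%C.
Proof.
  destruct (Cmod_unimodular z) as (c & Hc & E). exists (Cconj c). split.
  - now rewrite Cmod_conj.
  - rewrite <- E. replace (c * z * Cconj c)%C with (c * Cconj c * z)%C by ring.
    rewrite <- Cmod2_conj, Hc. rewrite pow1. ring.
Qed.

Lemma PSeries_constant_term (c t : R) :
  PSeries (fun n => match n with O => c | S _ => 0 end) t = c.
Proof.
  apply is_pseries_unique, is_pseries_R.
  apply is_series_decr_1.
  apply is_Rseries_ext with (fun n => 0).
  - intros n. ring.
  - assert (H := is_Rseries_scal 0 _ _ (is_series_geom 0 ltac:(rewrite Rabs_R0; lra))).
    match goal with |- is_series _ ?l => replace l with (0 * / (1 - 0)) end.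
    + apply is_Rseries_ext with (2 := H). intros n; ring.
    + unfold plus, opp; simpl. ring.
Qed.

(** * The weights and the lower growth series *)

(** [1 + alpha n] is the multiplier of [u + alpha t u'] and [n + 1] that of [u + t u']; this
    splitting allows the two to be inverted separately. *)
Lemma weight_factor (alpha : R) (n : nat) :
  radius_weight alpha (S n) = (1 + alpha * INR n) * INR (S n).
Proof. unfold radius_weight. rewrite S_INR. ring. Qed.

Lemma weight_ge (alpha : R) (n : nat) :
  0 <= alpha -> INR (S n) <= radius_weight alpha (S n).
Proof.
  intros Ha. rewrite weight_factor. assert (A := pos_INR n). assert (B := pos_INR (S n)).
  assert (0 <= alpha * INR n) by now apply Rmult_le_pos. nra.
Qed.

Lemma weight_pos (alpha : R) (n : nat) : 0 <= alpha -> 0 < radius_weight alpha (S n).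
Proof.
  intros Ha. eapply Rlt_le_trans; [|now apply weight_ge].
  apply lt_0_INR; lia.
Qed.

(* Coefficients of [L r / r], where [L r = r + 2 * sum_(n >= 2) (-1)^(n-1) r^n / w n] is the
   lower growth bound of the class. *)
Definition growth_coef (alpha : R) (n : nat) : R :=
  match n with O => 1 | S _ => 2 * (-1) ^ n / radius_weight alpha (S n) end.

Lemma growth_coef_bounded (alpha : R) (n : nat) :
  0 <= alpha -> Rabs (INR (S n) * growth_coef alpha n) <= 2.
Proof.
  intros Ha. destruct n as [|n].
  - simpl. rewrite Rmult_1_l, Rabs_R1. lra.
  - unfold growth_coef. assert (A := weight_ge alpha (S n) Ha).
    assert (B := weight_pos alpha (S n) Ha). assert (P := pos_INR (S (S n))).
    unfold Rdiv. rewrite !Rabs_mult, pow_1_abs, Rabs_inv.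
    rewrite (Rabs_right 2), (Rabs_right (radius_weight _ _)), (Rabs_right (INR _)) by lra.
    apply Rmult_le_reg_r with (radius_weight alpha (S (S n))); auto. field_simplify; lra.
Qed.

Lemma disk_summable_growth (alpha : R) :
  0 <= alpha -> disk_summable (fun n => INR (S n) * growth_coef alpha n).
Proof.
  intros Ha. apply disk_summable_bounded with 2. intros; now apply growth_coef_bounded.
Qed.

Lemma disk_summable_growth_coef (alpha : R) :
  0 <= alpha -> disk_summable (growth_coef alpha).
Proof.
  intros Ha. apply disk_summable_le with (2 := disk_summable_growth alpha Ha).
  intros n. rewrite Rabs_mult, (Rabs_right (INR (S n))) by (apply Rle_ge, pos_INR).
  assert (1 <= INR (S n)) by (rewrite S_INR; generalize (pos_INR n); lra).
  generalize (Rabs_pos (growth_coef alpha n)); nra.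
Qed.

(** The two multipliers cancel the weight and leave [1 - 2 t + 2 t ^ 2 - ...], which is
    [2 / (1 + t) - 1]. *)
Lemma PSeries_growth_euler (alpha t : R) :
  0 <= alpha -> 0 <= t < 1 ->
  PSeries (fun n => (1 + alpha * INR n) * (INR (S n) * growth_coef alpha n)) t
  = (1 - t) / (1 + t).
Proof.
  intros Ha Ht. apply is_pseries_unique, is_pseries_R.
  assert (G := is_series_geom (- t) ltac:(rewrite Rabs_Ropp, Rabs_right; lra)).
  apply (is_Rseries_scal 2) in G.
  (* The geometric series of ratio 0 is 1, 0, 0, ...; subtracting it changes the constant term from
     2 to 1 and nothing else. *)
  assert (E := is_series_geom 0 ltac:(rewrite Rabs_R0; lra)).
  apply (is_Rseries_minus _ _ _ _ G) in E.
  replace ((1 - t) / (1 + t)) with (2 * / (1 - - t) - / (1 - 0)) by (field; lra).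
  apply is_Rseries_ext with (2 := E). intros n. destruct n as [|n].
  - simpl. ring.
  - unfold growth_coef. rewrite <- (Rmult_assoc (1 + alpha * INR (S n))), <- weight_factor.
    replace (- t) with (-1 * t) by ring. rewrite Rpow_mult_distr.
    rewrite pow_i by lia. field. apply Rgt_not_eq, weight_pos; auto.
Qed.

Lemma cps_ext (a b : nat -> C) (z : C) : (forall n, a n = b n) -> cps a z = cps b z.
Proof. intros H. apply csum_ext. intros n. now rewrite H. Qed.

Lemma cps_plus_scal (a b : nat -> C) (c z : C) :
  cdisk_summable a -> cdisk_summable b -> Cmod z < 1 ->
  cps (fun n => a n + c * b n)%C z = (cps a z + c * cps b z)%C.
Proof.
  intros Ha Hb Hz. apply cps_unique; auto.
  - apply cdisk_summable_plus; auto. now apply cdisk_summable_scal.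
  - apply is_cseries_ext with (fun n => a n * z ^ n + c * (b n * z ^ n))%C.
    + intros n; ring.
    + apply is_cseries_plus; [|apply is_cseries_scal]; now apply cps_correct.
Qed.

(** * Bounds for one function whose weighted series has nonnegative real part *)

(** When [D] lists the coefficients of [h z / z], these are the coefficients of
    [h' + alpha z h'']. *)
Definition weighted (alpha : R) (D : nat -> C) (n : nat) : C :=
  (RtoC (1 + alpha * INR n) * (RtoC (INR (S n)) * D n))%C.

Lemma cdisk_summable_succ_mul (D : nat -> C) :
  cdisk_summable D -> cdisk_summable (fun n => RtoC (INR (S n)) * D n)%C.
Proof.
  intros H. apply disk_summable_le with (fun n => Cmod (RtoC (INR n) * D n + D n)).
  - intros n. rewrite S_INR, RtoC_plus. right. do 2 f_equal. ring.
  - apply cdisk_summable_plus; auto. now apply cdisk_summable_mul_INR.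
Qed.

Lemma cdisk_summable_euler (alpha : R) (D : nat -> C) :
  cdisk_summable D -> cdisk_summable (fun n => RtoC (1 + alpha * INR n) * D n)%C.
Proof.
  intros H.
  apply disk_summable_le with (fun n => Cmod (D n + RtoC alpha * (RtoC (INR n) * D n))).
  - intros n. rewrite RtoC_plus, RtoC_mult. right. do 2 f_equal. ring.
  - apply cdisk_summable_plus; auto.
    now apply cdisk_summable_scal, cdisk_summable_mul_INR.
Qed.

Lemma cdisk_summable_weighted (alpha : R) (D : nat -> C) :
  cdisk_summable D -> cdisk_summable (weighted alpha D).
Proof. intros H. now apply cdisk_summable_euler, cdisk_summable_succ_mul. Qed.

Definition positive_weighted (alpha : R) (D : nat -> C) : Prop :=
  cdisk_summable D /\ D 0%nat = RtoC 1 /\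
  forall z, Cmod z < 1 -> 0 <= Re (cps (weighted alpha D) z).

Lemma weighted_0 (alpha : R) (D : nat -> C) :
  D 0%nat = RtoC 1 -> weighted alpha D 0%nat = RtoC 1.
Proof. intros HD0. unfold weighted. rewrite HD0. simpl. rewrite Rmult_0_r, Rplus_0_r. ring. Qed.

Lemma coef_bound (alpha : R) (D : nat -> C) (n : nat) :
  0 <= alpha -> positive_weighted alpha D ->
  Cmod (D (S n)) <= 2 / radius_weight alpha (S (S n)).
Proof.
  intros Halpha (HD & HD0 & Hpos).
  assert (H := caratheodory _ n (cdisk_summable_weighted alpha D HD)
                 (weighted_0 alpha D HD0) Hpos).
  unfold weighted in H. rewrite Cmult_assoc, <- RtoC_mult, <- weight_factor in H.
  assert (W := weight_pos alpha (S n) Halpha).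
  rewrite Cmod_mult, Cmod_R, Rabs_right in H by lra.
  apply Rmult_le_reg_r with (radius_weight alpha (S (S n))); auto. field_simplify; lra.
Qed.

Lemma harnack_weighted (alpha : R) (D : nat -> C) (u : C) (t : R) :
  positive_weighted alpha D -> Cmod u = 1 -> 0 <= t < 1 ->
  (1 - t) / (1 + t) <= Re (cps (weighted alpha D) (RtoC t * u)).
Proof.
  intros (HD & HD0 & Hpos) Hu Ht.
  assert (E : Cmod (RtoC t * u) = t) by (rewrite Cmod_mult, Cmod_R, Hu, Rabs_right; lra).
  rewrite <- E at 1 2. apply harnack; auto.
  - now apply cdisk_summable_weighted.
  - now apply weighted_0.
  - lra.
Qed.

(** Harnack's bound decreases in the radius, so its value at [rho] is a constant minorant on the
    whole segment, and constants are fixed by [u + alpha t u']. One inversion suffices to reach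
    [h']. *)
Lemma derivative_lower_bound (alpha : R) (D : nat -> C) (rho : R) (z : C) :
  0 <= alpha -> positive_weighted alpha D -> rho < 1 -> Cmod z <= rho ->
  (1 - rho) / (1 + rho) <= Re (cps (fun n => RtoC (INR (S n)) * D n)%C z).
Proof.
  intros Halpha HW HR Hz. assert (HD := proj1 HW). assert (P := Cmod_ge_0 z). destruct (polar_form z) as (u & Hu & E).
  rewrite E. rewrite <- (PSeries_constant_term ((1 - rho) / (1 + rho)) (Cmod z)).
  apply euler_operator_radial with alpha rho; auto; try lra.
  - now apply cdisk_summable_succ_mul.
  - apply disk_summable_bounded with (Rabs ((1 - rho) / (1 + rho))).
    intros [|n]; [lra|]. rewrite Rabs_R0. apply Rabs_pos.
  - intros t Ht. eapply Rle_trans; [|apply harnack_weighted; auto; lra].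
    apply Rle_trans with ((1 - rho) / (1 + rho)).
    + right. erewrite PSeries_ext; [apply PSeries_constant_term|].
      intros [|n]; simpl; ring.
    + unfold Rdiv. apply Rmult_le_compat; try lra.
      * apply Rlt_le, Rinv_0_lt_compat; lra.
      * apply Rinv_le_contravar; lra.
Qed.

(** Two inversions: the outer one with parameter 1, leading from [h'] to [h z / z], and the inner
    one with [alpha], whose hypothesis is Harnack's bound itself by [PSeries_growth_euler]. *)
Lemma quotient_lower_bound (alpha : R) (D : nat -> C) (z : C) :
  0 <= alpha -> positive_weighted alpha D -> Cmod z < 1 -> PSeries (growth_coef alpha) (Cmod z) <= Re (cps D z).
Proof.
  intros Halpha HW Hz. assert (HD := proj1 HW). assert (P := Cmod_ge_0 z).
  destruct (polar_form z) as (u & Hu & E).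
  rewrite E at 2.
  apply euler_operator_radial with 1 (Cmod z); auto; try lra.
  - now apply disk_summable_growth_coef.
  - intros t Ht.
    rewrite (PSeries_ext _ (fun n => INR (S n) * growth_coef alpha n))
      by (intros n; rewrite S_INR; f_equal; ring).
    rewrite (cps_ext _ (fun n => RtoC (INR (S n)) * D n)%C)
      by (intros n; rewrite S_INR; do 2 f_equal; ring).
    apply euler_operator_radial with alpha (Cmod z); auto; try lra.
    + now apply cdisk_summable_succ_mul.
    + now apply disk_summable_growth.
    + intros s Hs. rewrite PSeries_growth_euler by lra. apply harnack_weighted; auto; lra.
Qed.

(** * Surjectivity of strongly monotone maps of a disk *)

Definition cdot (x y : C) : R := Re (x * Cconj y).

Lemma cdot_self (x : C) : cdot x x = Cmod x ^ 2.
Proof. unfold cdot. now rewrite <- Cmod2_conj, re_RtoC. Qed.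

Lemma cdot_sym (x y : C) : cdot x y = cdot y x.
Proof. unfold cdot. destruct x, y; simpl. ring. Qed.

Lemma cdot_minus_l (x y z : C) : cdot (x - y) z = cdot x z - cdot y z.
Proof. unfold cdot. destruct x, y, z; simpl. ring. Qed.

Lemma cdot_minus_r (x y z : C) : cdot x (y - z) = cdot x y - cdot x z.
Proof. unfold cdot. destruct x, y, z; simpl. ring. Qed.

Lemma cdot_scal_l (r : R) (x y : C) : cdot (r * x) y = r * cdot x y.
Proof. unfold cdot. destruct x, y; simpl. ring. Qed.

Lemma cdot_scal_r (r : R) (x y : C) : cdot x (r * y) = r * cdot x y.
Proof. unfold cdot. destruct x, y; simpl. ring. Qed.

Lemma cdot_le (x y : C) : cdot x y <= Cmod x * Cmod y.
Proof.
  unfold cdot. eapply Rle_trans; [apply Re_le_Cmod|]. rewrite Cmod_mult, Cmod_conj. lra.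
Qed.

Definition disk_proj (rho : R) (y : C) : C :=
  if Rle_dec (Cmod y) rho then y else (RtoC (rho / Cmod y) * y)%C.

Lemma disk_proj_in (rho : R) (y : C) : 0 <= rho -> Cmod (disk_proj rho y) <= rho.
Proof.
  intros Hr. unfold disk_proj. destruct Rle_dec as [H|H]; auto.
  apply Rnot_le_lt in H. rewrite Cmod_mult, Cmod_R.
  rewrite Rabs_right; [right; field; lra|].
  apply Rle_ge, Rmult_le_pos; auto. apply Rlt_le, Rinv_0_lt_compat. lra.
Qed.

(** The variational inequality of the nearest point of a convex set. Outside the disk, [y] minus its
    projection is a positive multiple of [y], and the claim is Cauchy-Schwarz. *)
Lemma disk_proj_obtuse (rho : R) (y v : C) :
  0 <= rho -> Cmod v <= rho -> cdot (y - disk_proj rho y) (v - disk_proj rho y) <= 0.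
Proof.
  intros Hr Hv. unfold disk_proj. destruct Rle_dec as [H|H].
  - replace (y - y)%C with (RtoC 0 * y)%C by ring. rewrite cdot_scal_l. lra.
  - apply Rnot_le_lt in H. set (s := rho / Cmod y).
    assert (Hs : s * Cmod y = rho) by (unfold s; field; lra).
    assert (Hs1 : 0 <= s <= 1) by (split; nra).
    replace (y - s * y)%C with (RtoC (1 - s) * y)%C by (rewrite RtoC_minus; ring).
    rewrite cdot_scal_l, cdot_minus_r, cdot_scal_r, cdot_self.
    assert (A := cdot_le y v). assert (Cmod y * Cmod v <= Cmod y * rho)
      by (apply Rmult_le_compat_l; lra).
    assert (s * Cmod y ^ 2 = Cmod y * rho) by (rewrite <- Hs; ring).
    assert (cdot y v - s * Cmod y ^ 2 <= 0) by lra. nra.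
Qed.

(** Adding the two obtuse-angle inequalities gives [Cmod (p - q) ^ 2 <= cdot (x - y) (p - q)];
    Cauchy-Schwarz concludes. *)
Lemma disk_proj_nonexpansive (rho : R) (x y : C) :
  0 <= rho -> Cmod (disk_proj rho x - disk_proj rho y) <= Cmod (x - y).
Proof.
  intros Hr.
  assert (A := disk_proj_obtuse rho x (disk_proj rho y) Hr (disk_proj_in rho y Hr)).
  assert (B := disk_proj_obtuse rho y (disk_proj rho x) Hr (disk_proj_in rho x Hr)).
  set (p := disk_proj rho x) in *. set (q := disk_proj rho y) in *.
  assert (Hc := cdot_le (x - y) (p - q)). assert (Hs := cdot_self (p - q)).
  rewrite !cdot_minus_l, !cdot_minus_r in *.
  rewrite (cdot_sym q p) in *.
  assert (H : Cmod (p - q) ^ 2 <= Cmod (x - y) * Cmod (p - q)) by lra.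
  assert (P := Cmod_ge_0 (p - q)). assert (Q := Cmod_ge_0 (x - y)).
  destruct (Req_dec (Cmod (p - q)) 0) as [E|E]; [lra|]. nra.
Qed.

(** The increments form an absolutely convergent series, and its partial sums telescope to
    [z (S n) - z 0]. *)
Lemma iterates_converge (z : nat -> C) (q M : R) :
  0 <= q < 1 -> (forall n, Cmod (z (S n) - z n) <= M * q ^ n) ->
  exists s, is_lim_seq (fun n => Cmod (z n - s)) 0.
Proof.
  intros Hq H.
  assert (E : ex_series (fun n => Cmod (z (S n) - z n))).
  { apply ex_Rseries_le with (fun n => M * q ^ n).
    - intros n. rewrite Rabs_right by apply Rle_ge, Cmod_ge_0. apply H.
    - apply (@ex_series_scal R_AbsRing R_NormedModule). apply ex_series_geom.
      rewrite Rabs_right; lra. }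
  apply csum_correct in E. set (l := csum _) in E.
  apply is_cseries_iff in E as [E1 E2].
  exists (z 0%nat + l)%C.
  assert (HTel : forall v : nat -> R, forall n,
            sum_n (fun k => v (S k) - v k) n = v (S n) - v 0%nat).
  { intros v n. induction n as [|n IH].
    - now rewrite sum_O.
    - rewrite sum_n_Sn_R, IH. Rring. }
  assert (F1 : is_lim_seq (fun n => Re (z (S n)) - Re (z 0%nat)) (Re l)).
  { apply is_lim_seq_ext with (sum_n (fun k => Re (z (S k)) - Re (z k))).
    - intros n. apply (HTel (fun n => Re (z n))).
    - apply (is_Rseries_ext _ _ _ (fun n => eq_refl) E1). }
  assert (F2 : is_lim_seq (fun n => Im (z (S n)) - Im (z 0%nat)) (Im l)).
  { apply is_lim_seq_ext with (sum_n (fun k => Im (z (S k)) - Im (z k))).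
    - intros n. apply (HTel (fun n => Im (z n))).
    - apply (is_Rseries_ext _ _ _ (fun n => eq_refl) E2). }
  apply is_lim_seq_incr_1.
  apply is_lim_seq_le_le with (fun _ => 0)
    (fun n => Rabs (Re (z (S n)) - Re (z 0%nat) - Re l)
              + Rabs (Im (z (S n)) - Im (z 0%nat) - Im l)).
  - intros n; split; [apply Cmod_ge_0|]. eapply Rle_trans; [apply Cmod_le_Re_Im|].
    right. destruct (z (S n)), (z 0%nat), l; simpl. f_equal; f_equal; ring.
  - apply is_lim_seq_const.
  - replace (Finite 0) with (Finite (Rabs (Re l - Re l) + Rabs (Im l - Im l)))
      by (f_equal; rewrite !Rminus_diag, Rabs_R0; ring).
    apply is_lim_seq_plus'; apply (is_lim_seq_abs _ (Finite _));
      apply is_lim_seq_minus'; auto; apply is_lim_seq_const.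
Qed.

(* Browder-Minty on a disk: [z |-> proj (z - lambda * (f z - w))] is a contraction, and
   the boundary condition rules out a fixed point at which the projection is active. *)
Lemma strongly_monotone_surjective (f : C -> C) (rho c L : R) (w : C) :
  0 < rho -> 0 < c <= L ->
  (forall x y, Cmod x <= rho -> Cmod y <= rho ->
     c * Cmod (x - y) ^ 2 <= cdot (f x - f y) (x - y)) ->
  (forall x y, Cmod x <= rho -> Cmod y <= rho -> Cmod (f x - f y) <= L * Cmod (x - y)) ->
  (forall z, Cmod z = rho -> 0 < cdot (f z - w) z) ->
  exists z, Cmod z <= rho /\ f z = w.
Proof.
  intros Hrho HcL Hmon Hlip Hbd.
  (* The step [lam] minimizes [1 - 2 lam c + lam ^ 2 L ^ 2], the squared contraction factor; the
     minimum is [1 - c ^ 2 / L ^ 2]. *)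
  set (lam := c / L ^ 2). set (T := fun z => disk_proj rho (z - RtoC lam * (f z - w))).
  assert (HL2 : 0 < L ^ 2) by (apply pow_lt; lra).
  assert (Hlam : 0 < lam) by (apply Rdiv_lt_0_compat; lra).
  assert (Hq0 : 0 <= 1 - c ^ 2 / L ^ 2 < 1).
  { assert (0 < c ^ 2 / L ^ 2) by (apply Rdiv_lt_0_compat; auto; apply pow_lt; lra).
    assert (c ^ 2 / L ^ 2 <= 1).
    { apply Rmult_le_reg_r with (L ^ 2); auto. unfold Rdiv.
      rewrite Rmult_assoc, Rinv_l by lra. nra. }
    lra. }
  set (q := sqrt (1 - c ^ 2 / L ^ 2)).
  assert (Hqq : q ^ 2 = 1 - c ^ 2 / L ^ 2) by (unfold q; rewrite pow2_sqrt; lra).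
  assert (Hq : 0 <= q < 1).
  { split; [apply sqrt_pos|]. unfold q. rewrite <- sqrt_1 at 2. apply sqrt_lt_1; lra. }
  assert (HTin : forall z, Cmod (T z) <= rho) by (intros z; apply disk_proj_in; lra).
  assert (HT : forall x y, Cmod x <= rho -> Cmod y <= rho ->
             Cmod (T x - T y) <= q * Cmod (x - y)).
  { intros x y Hx Hy. eapply Rle_trans; [apply disk_proj_nonexpansive; lra|].
    apply Rsqr_incr_0_var.
    2: { apply Rmult_le_pos; [lra|apply Cmod_ge_0]. }
    rewrite !Rsqr_pow2, Rpow_mult_distr, Hqq.
    replace (x - lam * (f x - w) - (y - lam * (f y - w)))%C
      with ((x - y) - RtoC lam * (f x - f y))%C by ring.
    rewrite <- cdot_self. specialize (Hmon x y Hx Hy). specialize (Hlip x y Hx Hy).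
    set (d := (x - y)%C) in *. set (e := (f x - f y)%C) in *.
    rewrite !cdot_minus_l, !cdot_minus_r, !cdot_scal_l, !cdot_scal_r, !cdot_self.
    rewrite (cdot_sym d e).
    assert (He : Cmod e ^ 2 <= L ^ 2 * Cmod d ^ 2).
    { rewrite <- Rpow_mult_distr. apply pow_incr. split; [apply Cmod_ge_0|auto]. }
    assert (E1 : lam * (lam * (L ^ 2 * Cmod d ^ 2)) = c ^ 2 / L ^ 2 * Cmod d ^ 2)
      by (unfold lam; field; lra).
    assert (E2 : lam * (c * Cmod d ^ 2) = c ^ 2 / L ^ 2 * Cmod d ^ 2)
      by (unfold lam; field; lra).
    assert (lam * (lam * Cmod e ^ 2) <= lam * (lam * (L ^ 2 * Cmod d ^ 2)))
      by (do 2 (apply Rmult_le_compat_l; [lra|]); auto).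
    assert (lam * (c * Cmod d ^ 2) <= lam * cdot e d)
      by (apply Rmult_le_compat_l; [lra|auto]).
    lra. }
  set (z := fix it n := match n with O => RtoC 0 | S m => T (it m) end).
  assert (Hz : forall n, Cmod (z n) <= rho).
  { intros [|n]; simpl; [rewrite Cmod_0; lra | apply HTin]. }
  destruct (iterates_converge z q (Cmod (z 1%nat - z 0%nat)) Hq) as [s Hs].
  { induction n as [|n IH]; [simpl pow; lra|].
    change (z (S (S n))) with (T (z (S n))). change (z (S n)) with (T (z n)) at 2.
    eapply Rle_trans; [apply HT; apply Hz|]. rewrite <- tech_pow_Rmult.
    apply Rmult_le_compat_l with (r := q) in IH; lra. }
  assert (Hsin : Cmod s <= rho).
  { apply (is_lim_seq_le (fun _ => Cmod s) (fun n => Cmod (z n - s) + rho)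
             (Finite (Cmod s)) (Finite rho)).
    - intros n. replace s with (- (z n - s) + z n)%C at 1 by ring.
      eapply Rle_trans; [apply Cmod_triangle|]. rewrite Cmod_opp. generalize (Hz n); lra.
    - apply is_lim_seq_const.
    - replace (Finite rho) with (Finite (0 + rho)) by (f_equal; ring).
      apply is_lim_seq_plus'; [auto|apply is_lim_seq_const]. }
  assert (Hfix : T s = s).
  { apply Ceq_minus, Cmod_eq_0, Rle_antisym; [|apply Cmod_ge_0].
    apply (is_lim_seq_le (fun _ => Cmod (T s - s))
       (fun n => q * Cmod (z n - s) + Cmod (z (S n) - s)) (Finite (Cmod (T s - s))) (Finite 0)).
    - intros n. replace (T s - s)%C with (- (T (z n) - T s) + (z (S n) - s))%C
        by (simpl; ring).
      eapply Rle_trans; [apply Cmod_triangle|]. rewrite Cmod_opp.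
      apply Rplus_le_compat_r. now apply HT.
    - apply is_lim_seq_const.
    - replace (Finite 0) with (Finite (q * 0 + 0)) by (f_equal; ring). apply is_lim_seq_plus'.
      + now apply (is_lim_seq_scal_l _ q 0).
      + now apply (is_lim_seq_incr_1 (fun n => Cmod (z n - s))). }
  exists s; split; auto. unfold T, disk_proj in Hfix.
  set (y := (s - RtoC lam * (f s - w))%C) in *.
  assert (Hnz : RtoC lam <> RtoC 0) by (intros E; apply RtoC_inj in E; lra).
  destruct Rle_dec as [H|H].
  - apply Ceq_minus. replace (f s - w)%C with ((s - y) / RtoC lam)%C
      by (unfold y; field; auto). rewrite Hfix. field; auto.
  (* An active projection puts [s] on the circle, with [y] a longer multiple of [s]. Then [lam *
     cdot (f s - w) s = rho ^ 2 - rho * Cmod y < 0], against the boundary condition. *)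
  - exfalso. apply Rnot_le_lt in H.
    assert (Hns : Cmod s = rho).
    { rewrite <- Hfix, Cmod_mult, Cmod_R, Rabs_right; [field; lra|].
      apply Rle_ge, Rlt_le, Rdiv_lt_0_compat; lra. }
    specialize (Hbd s Hns).
    assert (E : (RtoC lam * (f s - w) = s - y)%C) by (unfold y; ring).
    assert (E2 : lam * cdot (f s - w) s = cdot s s - cdot y s)
      by now rewrite <- cdot_scal_l, E, cdot_minus_l.
    assert (E3 : cdot s s = rho / Cmod y * cdot y s) by (rewrite <- cdot_scal_l; now rewrite Hfix).
    rewrite cdot_self, Hns in *.
    assert (E4 : cdot y s = rho * Cmod y).
    { apply Rmult_eq_reg_l with (rho / Cmod y); [rewrite <- E3; field; lra|].
      apply Rgt_not_eq, Rdiv_lt_0_compat; lra. }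
    rewrite E4 in E2. assert (0 < lam * cdot (f s - w) s) by now apply Rmult_lt_0_compat.
    nra.
Qed.

(** * Bounds for the class *)

Lemma cps_mul_z (a : nat -> C) (z : C) :
  cdisk_summable a -> Cmod z < 1 ->
  cps a z = (a 0%nat + z * cps (fun n => a (S n)) z)%C.
Proof.
  intros Ha Hz. apply cps_unique; auto.
  assert (H := cps_correct _ z (cdisk_summable_shift a Ha) Hz).
  apply (is_cseries_scal z) in H.
  replace (a 0%nat + z * cps (fun n => a (S n)) z)%C
    with (z * cps (fun n => a (S n)) z + a 0%nat * z ^ 0)%C by (simpl; ring).
  apply (is_cseries_decr_1 (fun n => a n * z ^ n)%C).
  apply is_cseries_ext with (2 := H). intros n. simpl. ring.
Qed.

(* Here and below [A] and [B] are the coefficients of [h z / z] and [g z / z]. *)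
Definition class_coefs (alpha : R) (A B : nat -> C) : Prop :=
  cdisk_summable A /\ cdisk_summable B /\ A 0%nat = RtoC 1 /\ B 0%nat = RtoC 0 /\
  forall z, Cmod z < 1 ->
    Cmod (cps (weighted alpha B) z) < Re (cps (weighted alpha A) z).

Definition succ_mul (A : nat -> C) (n : nat) : C := (RtoC (INR (S n)) * A n)%C.

Lemma cps_euler (alpha : R) (Q : nat -> C) (z : C) :
  cdisk_summable Q -> Cmod z < 1 ->
  (cps Q z + RtoC alpha * z * cps (cderiv Q) z)%C
  = cps (fun n => RtoC (1 + alpha * INR n) * Q n)%C z.
Proof.
  intros HQ Hz.
  rewrite (cps_ext (fun n => RtoC (1 + alpha * INR n) * Q n)%C
             (fun n => Q n + RtoC alpha * (RtoC (INR n) * Q n))%C)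
    by (intros n; rewrite RtoC_plus, RtoC_mult; ring).
  rewrite cps_plus_scal by (auto; now apply cdisk_summable_mul_INR).
  rewrite (cps_mul_z (fun n => RtoC (INR n) * Q n)%C)
    by (auto; now apply cdisk_summable_mul_INR).
  change (fun n => (RtoC (INR (S n)) * Q (S n))%C) with (cderiv Q). simpl (INR 0). ring.
Qed.

Lemma operator_of_power_series (alpha : R) (h : C -> C) (A : nat -> C) :
  cdisk_summable A -> (forall z, Cmod z < 1 -> h z = (z * cps A z)%C) ->
  (forall z, Cmod z < 1 -> @is_derive C_AbsRing C_NormedModule h z (cps (succ_mul A) z)) /\
  (forall z, Cmod z < 1 ->
    (C_derive h z + RtoC alpha * z * C_derive (C_derive h) z)%C = cps (weighted alpha A) z).
Proof.
  intros HA Hh. set (P := fun n => match n with O => RtoC 0 | S k => A k end).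
  assert (HP : cdisk_summable P).
  { intros r Hr. apply ex_series_incr_1.
    apply ex_Rseries_ext with (fun n => r * (Rabs (Cmod (A n)) * r ^ n)).
    - intros n. unfold P. rewrite <- tech_pow_Rmult. ring.
    - apply (@ex_series_scal R_AbsRing R_NormedModule). now apply HA. }
  assert (HhP : forall z, Cmod z < 1 -> h z = cps P z).
  { intros z Hz. rewrite Hh, (cps_mul_z P) by auto. change (fun n => P (S n)) with A. simpl. ring. }
  assert (HQ : cdisk_summable (cderiv P)) by now apply cdisk_summable_deriv.
  split.
  - intros z Hz. apply (is_derive_of_power_series h P HP HhP z Hz).
  - assert (D1 := C_derive_of_power_series h P HP HhP).
    assert (D2 := C_derive_of_power_series (C_derive h) (cderiv P) HQ D1).
    intros z Hz. rewrite D1, D2 by auto. rewrite cps_euler by auto. reflexivity.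
Qed.

(** Serves both parts: [c] is the coefficient of [z], 1 for [h] and 0 for [g], and takes the place
    of [a 1]. *)
Lemma power_series_coefs (h : C -> C) (a : nat -> C) (c : C) :
  (forall z, Cmod z < 1 ->
     is_cseries (fun k => a (2 + k)%nat * z ^ (2 + k))%C (h z - c * z)%C) ->
  let A := fun n => match n with O => c | S _ => a (S n) end in
  cdisk_summable A /\ forall z, Cmod z < 1 -> h z = (z * cps A z)%C.
Proof.
  intros H A.
  set (P := fun n => match n with O => RtoC 0 | S k => A k end).
  assert (HP : forall z, Cmod z < 1 -> is_cseries (fun n => P n * z ^ n)%C (h z)).
  { intros z Hz.
    replace (h z) with (h z - c * z + P 1%nat * z ^ 1 + P 0%nat * z ^ 0)%C
      by (unfold P, A; simpl; ring).
    apply (is_cseries_decr_1 (fun n => P n * z ^ n)%C).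
    apply (is_cseries_decr_1 (fun n => P (S n) * z ^ (S n))%C).
    exact (H z Hz). }
  assert (HS := cdisk_summable_of_converges _ _ HP).
  split; [exact (cdisk_summable_shift P HS)|].
  intros z Hz. rewrite <- (cps_unique P z (h z) HS Hz (HP z Hz)), cps_mul_z by auto.
  change (fun n => P (S n)) with A. unfold P. ring.
Qed.

Lemma class_coefs_of_W0H (alpha : R) (f h g : C -> C) (a b : nat -> C) :
  class_W0H alpha f h g -> expansions h g a b ->
  exists A B : nat -> C,
    class_coefs alpha A B /\
    (forall n, A (S n) = a (S (S n)) /\ B (S n) = b (S (S n))) /\
    (forall z, Cmod z < 1 -> h z = (z * cps A z)%C) /\
    (forall z, Cmod z < 1 -> g z = (z * cps B z)%C).
Proof.
  intros [_ Hineq] Hexp.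
  destruct (power_series_coefs h a 1) as [HA Hh].
  { intros z Hz. rewrite Cmult_1_l. apply (proj1 (Hexp z Hz)). }
  destruct (power_series_coefs g b 0) as [HB Hg].
  { intros z Hz. replace (g z - 0 * z)%C with (g z) by ring. apply (proj2 (Hexp z Hz)). }
  do 2 eexists. split; [|split; [|split; [exact Hh|exact Hg]]].
  - do 2 (split; [assumption|]). do 2 (split; [reflexivity|]). intros z Hz.
    rewrite <- (proj2 (operator_of_power_series alpha h _ HA Hh)) by auto.
    rewrite <- (proj2 (operator_of_power_series alpha g _ HB Hg)) by auto.
    now apply Hineq.
  - now intros n.
Qed.

Lemma class_coefs_combination (alpha : R) (A B : nat -> C) (e : C) :
  class_coefs alpha A B -> Cmod e = 1 ->
  positive_weighted alpha (fun n => A n + e * B n)%C.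
Proof.
  intros (HA & HB & HA0 & HB0 & H) He. split; [|split].
  - apply cdisk_summable_plus; auto. now apply cdisk_summable_scal.
  - rewrite HA0, HB0. ring.
  - intros z Hz. specialize (H z Hz).
    rewrite (cps_ext _ (fun n => weighted alpha A n + e * weighted alpha B n)%C)
      by (intros n; unfold weighted; ring).
    rewrite cps_plus_scal by (auto using cdisk_summable_weighted).
    rewrite re_plus. assert (K := re_le_Cmod (e * cps (weighted alpha B) z)).
    rewrite Cmod_mult, He in K. apply Rabs_le_between in K. lra.
Qed.

(** Rotating [b] to the argument of [a] makes the triangle inequality an equality, so a bound for
    all combinations [a + e b] becomes one for the sum of the moduli. *)
Lemma Cmod_sum_attained (a b : C) :
  exists e : C, Cmod e = 1 /\ Cmod (a + e * b) = Cmod a + Cmod b.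
Proof.
  destruct (Cmod_unimodular a) as (c & Hc & Ea), (Cmod_unimodular b) as (d & Hd & Eb).
  exists (Cconj c * d)%C. split; [rewrite Cmod_mult, Cmod_conj, Hc, Hd; ring|].
  replace (Cmod (a + Cconj c * d * b)) with (Cmod (c * (a + Cconj c * d * b)))
    by (rewrite Cmod_mult, Hc; ring).
  replace (c * (a + Cconj c * d * b))%C with (c * a + c * Cconj c * (d * b))%C by ring.
  rewrite Ea, Eb, <- Cmod2_conj, Hc, <- RtoC_mult, <- RtoC_plus, Cmod_R.
  rewrite Rabs_right; [ring|]. generalize (Cmod_ge_0 a) (Cmod_ge_0 b); lra.
Qed.

Lemma class_coef_bound (alpha : R) (A B : nat -> C) (n : nat) :
  0 <= alpha -> class_coefs alpha A B ->
  Cmod (A (S n)) + Cmod (B (S n)) <= 2 / radius_weight alpha (S (S n)).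
Proof.
  intros Ha HC. destruct (Cmod_sum_attained (A (S n)) (B (S n))) as (e & He & <-).
  apply (coef_bound alpha _ n Ha (class_coefs_combination _ _ _ _ HC He)).
Qed.

Lemma Cmod_opposed (w : C) : exists e : C, Cmod e = 1 /\ (e * w)%C = RtoC (- Cmod w).
Proof.
  destruct (Cmod_unimodular w) as (c & Hc & E). exists (- c)%C. split.
  - now rewrite Cmod_opp.
  - rewrite RtoC_opp, <- E. ring.
Qed.

Lemma cdisk_summable_succ (A : nat -> C) : cdisk_summable A -> cdisk_summable (succ_mul A).
Proof. apply cdisk_summable_succ_mul. Qed.

(** Here [e] depends on the point [z]: it rotates the value of the second series onto the negative
    real axis. The same choice gives the bound for the quotients. *)
Lemma class_derivative_bound (alpha : R) (A B : nat -> C) (rho : R) (z : C) :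
  0 <= alpha -> class_coefs alpha A B -> rho < 1 -> Cmod z <= rho ->
  (1 - rho) / (1 + rho) + Cmod (cps (succ_mul B) z) <= Re (cps (succ_mul A) z).
Proof.
  intros Ha HC Hr Hz. destruct (Cmod_opposed (cps (succ_mul B) z)) as (e & He & E).
  assert (H := derivative_lower_bound alpha _ rho z Ha
                 (class_coefs_combination _ _ _ _ HC He) Hr Hz).
  rewrite (cps_ext _ (fun n => succ_mul A n + e * succ_mul B n)%C) in H
    by (intros n; unfold succ_mul; ring).
  destruct HC as (HA & HB & _).
  rewrite cps_plus_scal in H by (auto using cdisk_summable_succ; lra).
  rewrite re_plus, E, re_RtoC in H. lra.
Qed.

Lemma class_quotient_bound (alpha : R) (A B : nat -> C) (z : C) :
  0 <= alpha -> class_coefs alpha A B -> Cmod z < 1 ->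
  PSeries (growth_coef alpha) (Cmod z) + Cmod (cps B z) <= Re (cps A z).
Proof.
  intros Ha HC Hz. destruct (Cmod_opposed (cps B z)) as (e & He & E).
  assert (H := quotient_lower_bound alpha _ z Ha (class_coefs_combination _ _ _ _ HC He) Hz).
  destruct HC as (HA & HB & _).
  rewrite cps_plus_scal, re_plus, E, re_RtoC in H by auto. lra.
Qed.

(** * Strong monotonicity and the values taken on a smaller disk *)

Lemma is_derive_along_line (h : C -> C) (c z k l : C) (t : R) :
  @is_derive C_AbsRing C_NormedModule h (z + RtoC t * k)%C l ->
  derivable_pt_lim (fun s => Re (c * h (z + RtoC s * k)%C)) t (Re (c * l * k)).
Proof.
  intros [_ H] eps Heps.
  (* The [+ 1] makes [M] positive and leaves the factor [(M - 1) / M < 1], hence the strict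
     inequality that [derivable_pt_lim] asks for. *)
  set (M := Cmod c * Cmod k + 1).
  assert (HM : 0 < M).
  { unfold M. generalize (Rmult_le_pos _ _ (Cmod_ge_0 c) (Cmod_ge_0 k)); lra. }
  specialize (H _ (fun P HP => HP) (mkposreal _ (Rdiv_lt_0_compat _ _ Heps HM))).
  destruct H as [d Hd]. assert (Hdp := cond_pos d).
  assert (HK : 0 < Cmod k + 1) by (generalize (Cmod_ge_0 k); lra).
  exists (mkposreal _ (Rdiv_lt_0_compat _ _ Hdp HK)). intros s Hs0 Hs.
  change (Rabs s < d / (Cmod k + 1)) in Hs.
  set (y := (z + RtoC (t + s) * k)%C).
  assert (Ey : (y - (z + RtoC t * k))%C = (RtoC s * k)%C)
    by (unfold y; rewrite RtoC_plus; ring).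
  assert (Hsp : 0 < Rabs s) by now apply Rabs_pos_lt.
  assert (Hb : Cmod (y - (z + RtoC t * k))%C < d).
  { rewrite Ey, Cmod_mult, Cmod_R.
    apply Rmult_lt_compat_r with (r := Cmod k + 1) in Hs; auto.
    replace (d / (Cmod k + 1) * (Cmod k + 1)) with (pos d) in Hs by (field; lra).
    rewrite Rmult_plus_distr_l in Hs. lra. }
  specialize (Hd y Hb).
  change (Cmod (h y - h (z + RtoC t * k) - (y - (z + RtoC t * k)) * l)%C
          <= eps / M * Cmod (y - (z + RtoC t * k))%C) in Hd.
  cbv beta. fold y.
  rewrite Ey, Cmod_mult, Cmod_R in Hd.
  replace ((Re (c * h y) - Re (c * h (z + RtoC t * k)%C)) / s - Re (c * l * k))
    with (Re (c * (h y - h (z + RtoC t * k)%C - RtoC s * k * l)) / s).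
  2:{ replace (c * (h y - h (z + RtoC t * k)%C - RtoC s * k * l))%C
        with (c * h y - c * h (z + RtoC t * k)%C - RtoC s * (c * l * k))%C by ring.
      unfold Cminus. rewrite !re_plus, !re_opp, re_scal_l. field; auto. }
  unfold Rdiv at 1. rewrite Rabs_mult, Rabs_inv.
  apply Rmult_lt_reg_r with (Rabs s); auto.
  rewrite Rmult_assoc, Rinv_l, Rmult_1_r by lra.
  eapply Rle_lt_trans; [apply re_le_Cmod|]. rewrite Cmod_mult.
  apply Rle_lt_trans with (Cmod c * (eps / M * (Rabs s * Cmod k))).
  - apply Rmult_le_compat_l; [apply Cmod_ge_0|auto].
  - replace (Cmod c * (eps / M * (Rabs s * Cmod k)))
      with (eps * Rabs s * ((M - 1) / M)) by (unfold M; field; unfold M in HM; lra).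
    assert ((M - 1) / M < 1).
    { apply Rmult_lt_reg_r with M; auto. field_simplify; lra. }
    assert (0 < eps * Rabs s) by now apply Rmult_lt_0_compat.
    apply Rlt_le_trans with (eps * Rabs s * 1); [now apply Rmult_lt_compat_l|lra].
Qed.

(* Along a segment of direction [k], the derivative of [Re (conj k * f)] is
   [Re (|k|^2 h' + k^2 g') >= |k|^2 (Re h' - |g'|)]. *)
Lemma class_strongly_monotone (alpha : R) (A B : nat -> C) (h g : C -> C) (rho : R) (x y : C) :
  0 <= alpha -> class_coefs alpha A B ->
  (forall z, Cmod z < 1 -> h z = (z * cps A z)%C) ->
  (forall z, Cmod z < 1 -> g z = (z * cps B z)%C) ->
  rho < 1 -> Cmod x <= rho -> Cmod y <= rho ->
  (1 - rho) / (1 + rho) * Cmod (x - y) ^ 2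
  <= cdot (h x + Cconj (g x) - (h y + Cconj (g y))) (x - y).
Proof.
  intros Ha HC Hh Hg Hr Hx Hy. destruct (HC) as (HA & HB & _).
  set (k := (x - y)%C).
  (* [phi t] is [cdot (f (y + t k)) k]; conjugating the co-analytic term turns it into [Re (k * g)],
     so both summands are analytic functions along a line. *)
  set (phi := fun t : R => Re (Cconj k * h (y + RtoC t * k)%C) + Re (k * g (y + RtoC t * k)%C)).
  assert (Hseg : forall t, 0 <= t <= 1 -> Cmod (y + RtoC t * k) <= rho).
  { intros t Ht. replace (y + RtoC t * k)%C with (RtoC (1 - t) * y + RtoC t * x)%C
      by (unfold k; rewrite RtoC_minus; ring).
    eapply Rle_trans; [apply Cmod_triangle|]. rewrite !Cmod_mult, !Cmod_R, !Rabs_right by lra.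
    nra. }
  set (dphi := fun t : R => Re (Cconj k * cps (succ_mul A) (y + RtoC t * k)%C * k)
                 + Re (k * cps (succ_mul B) (y + RtoC t * k)%C * k)).
  assert (Hd : forall t, 0 <= t <= 1 -> derivable_pt_lim phi t (dphi t)).
  { intros t Ht. specialize (Hseg t Ht).
    apply derivable_pt_lim_plus; apply is_derive_along_line;
    apply (operator_of_power_series alpha); auto; lra. }
  destruct (MVT_cor2 phi dphi 0 1 Rlt_0_1 Hd) as (t & E & Ht).
  assert (E1 : phi 1 - phi 0 = cdot (h x + Cconj (g x) - (h y + Cconj (g y))) k).
  { unfold phi. replace (y + RtoC 1 * k)%C with x by (unfold k; ring).
    replace (y + RtoC 0 * k)%C with y by ring. unfold cdot.
    destruct k, (h x), (g x), (h y), (g y); simpl. ring. }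
  rewrite <- E1, E. rewrite Rminus_0_r, Rmult_1_r. unfold dphi.
  set (w := (y + RtoC t * k)%C).
  assert (D := class_derivative_bound alpha A B rho w Ha HC Hr (Hseg t ltac:(lra))).
  replace (Re (Cconj k * cps (succ_mul A) w * k)) with (Cmod k ^ 2 * Re (cps (succ_mul A) w)).
  2:{ rewrite <- re_scal_l, Cmod2_conj. f_equal. ring. }
  assert (K := re_le_Cmod (k * cps (succ_mul B) w * k)).
  rewrite !Cmod_mult in K. apply Rabs_le_between in K.
  assert (P := pow2_ge_0 (Cmod k)).
  apply Rmult_le_compat_l with (r := Cmod k ^ 2) in D; auto. nra.
Qed.

Lemma cpow_lipschitz (x y : C) (rho : R) (n : nat) :
  Cmod x <= rho -> Cmod y <= rho ->
  Cmod (x ^ n - y ^ n)%C <= INR n * rho ^ (pred n) * Cmod (x - y).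
Proof.
  intros Hx Hy. assert (Hr := Rle_trans _ _ _ (Cmod_ge_0 x) Hx).
  induction n as [|n IH].
  - simpl. replace (1 - 1)%C with (RtoC 0) by ring. rewrite Cmod_0. lra.
  - replace (x ^ S n - y ^ S n)%C with (x * (x ^ n - y ^ n) + y ^ n * (x - y))%C
      by (simpl; ring).
    eapply Rle_trans; [apply Cmod_triangle|]. rewrite !Cmod_mult, Cmod_pow.
    assert (Hyn : Cmod y ^ n <= rho ^ n) by (apply pow_incr; split; [apply Cmod_ge_0|auto]).
    assert (P := Cmod_ge_0 (x - y)).
    assert (Cmod y ^ n * Cmod (x - y) <= rho ^ n * Cmod (x - y))
      by now apply Rmult_le_compat_r.
    assert (Cmod x * Cmod (x ^ n - y ^ n) <= rho * (INR n * rho ^ pred n * Cmod (x - y)))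
      by (apply Rmult_le_compat; auto using Cmod_ge_0).
    replace (rho * (INR n * rho ^ pred n * Cmod (x - y)))
      with (INR n * rho ^ n * Cmod (x - y)) in *.
    + rewrite S_INR. simpl pred. lra.
    + destruct n; simpl pred; [simpl; ring|]. rewrite <- tech_pow_Rmult. ring.
Qed.

(** Termwise, with [L] the majorant of the derived series at [rho]. It supplies the Lipschitz
    hypothesis of the contraction argument. *)
Lemma cps_lipschitz (a : nat -> C) (rho : R) :
  cdisk_summable a -> 0 <= rho < 1 ->
  exists L, 0 <= L /\ forall x y, Cmod x <= rho -> Cmod y <= rho ->
    Cmod (x * cps a x - y * cps a y)%C <= L * Cmod (x - y).
Proof.
  intros Ha Hr.
  destruct (cdisk_summable_ex _ rho (cdisk_summable_succ a Ha) Hr) as [L HL].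
  exists L. split.
  { assert (P : forall n, 0 <= Cmod (succ_mul a n) * rho ^ n)
      by (intros n; apply Rmult_le_pos; [apply Cmod_ge_0|apply pow_le; lra]).
    assert (K := sum_n_le_is_series _ _ 0 P HL). rewrite sum_O in K.
    eapply Rle_trans; [apply (P 0%nat)|exact K]. }
  intros x y Hx Hy.
  assert (Sx := is_cseries_scal x _ _ (cps_correct a x Ha ltac:(lra))).
  assert (Sy := is_cseries_scal y _ _ (cps_correct a y Ha ltac:(lra))).
  assert (D := is_cseries_minus _ _ _ _ Sx Sy).
  assert (HB : forall n, Cmod (x * (a n * x ^ n) - y * (a n * y ^ n))%C
                 <= Cmod (x - y) * (Cmod (succ_mul a n) * rho ^ n)).
  { intros n. replace (x * (a n * x ^ n) - y * (a n * y ^ n))%C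
      with (a n * (x ^ S n - y ^ S n))%C by (simpl; ring).
    assert (K := cpow_lipschitz x y rho (S n) Hx Hy).
    unfold succ_mul. rewrite !Cmod_mult, Cmod_R, (Rabs_right (INR _)) by apply Rle_ge, pos_INR.
    apply Rmult_le_compat_l with (r := Cmod (a n)) in K; [|apply Cmod_ge_0].
    simpl pred in K. lra. }
  assert (HLs := is_Rseries_scal (Cmod (x - y)) _ _ HL).
  assert (HE : ex_series (fun n => Cmod (x * (a n * x ^ n) - y * (a n * y ^ n))%C)).
  { apply ex_Rseries_le with (2 := ex_intro _ _ HLs). intros n.
    rewrite Rabs_right by apply Rle_ge, Cmod_ge_0. apply HB. }
  eapply Rle_trans; [apply (Cmod_is_cseries_le _ _ _ D (Series_correct _ HE))|].
  rewrite (Rmult_comm L), <- (is_series_unique _ _ HLs).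
  apply Series_le; [|eexists; apply HLs]. intros n; split; [apply Cmod_ge_0|apply HB].
Qed.

(** On [Cmod z = rho] one has [cdot (f z) z = rho ^ 2 * Re (cps A z) + Re (z * z * cps B z)], at
    least [rho ^ 2 * PSeries (growth_coef alpha) rho] by the quotient bound. This exceeds
    [rho * Cmod w], hence [cdot w z]. *)
Lemma class_image_contains_disk (alpha : R) (A B : nat -> C) (h g : C -> C) (rho : R) (w : C) :
  0 <= alpha -> class_coefs alpha A B ->
  (forall z, Cmod z < 1 -> h z = (z * cps A z)%C) ->
  (forall z, Cmod z < 1 -> g z = (z * cps B z)%C) ->
  0 < rho < 1 -> Cmod w < rho * PSeries (growth_coef alpha) rho ->
  exists z, Cmod z < 1 /\ (h z + Cconj (g z))%C = w.
Proof.
  intros Ha HC Hh Hg Hr Hw. destruct (HC) as (HA & HB & _).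
  destruct (cps_lipschitz A rho HA ltac:(lra)) as (LA & HLA0 & HLA).
  destruct (cps_lipschitz B rho HB ltac:(lra)) as (LB & HLB0 & HLB).
  assert (Hc : 0 < (1 - rho) / (1 + rho)) by (apply Rdiv_lt_0_compat; lra).
  (* [LA + LB] is already a Lipschitz constant; the added summand ensures that it is at least the
     monotonicity constant and positive. *)
  destruct (strongly_monotone_surjective (fun z => h z + Cconj (g z))%C rho
    ((1 - rho) / (1 + rho)) (LA + LB + (1 - rho) / (1 + rho)) w) as (z & Hz & E);
    [lra|lra| | | |exists z; split; [lra|exact E]].
  - intros x y Hx Hy. apply (class_strongly_monotone alpha A B); auto; lra.
  - intros x y Hx Hy. specialize (HLA x y Hx Hy). specialize (HLB x y Hx Hy).
    rewrite <- !Hh in HLA by lra. rewrite <- !Hg in HLB by lra.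
    replace (h x + Cconj (g x) - (h y + Cconj (g y)))%C
      with ((h x - h y) + Cconj (g x - g y))%C by (rewrite Cminus_conj; ring).
    eapply Rle_trans; [apply Cmod_triangle|]. rewrite Cmod_conj.
    assert (P := Cmod_ge_0 (x - y)). nra.
  - intros z Hz. assert (Q := class_quotient_bound alpha A B z Ha HC ltac:(lra)).
    rewrite Hz in Q. rewrite Hh, Hg by lra. rewrite cdot_minus_l.
    assert (W := cdot_le w z). rewrite Hz in W.
    replace (cdot (z * cps A z + Cconj (z * cps B z)) z)
      with (Cmod z ^ 2 * Re (cps A z) + Re (z * z * cps B z)).
    2:{ unfold cdot. rewrite Cmult_plus_distr_r, re_plus, <- re_scal_l, Cmod2_conj.
        f_equal; [f_equal; ring|]. rewrite <- Cmult_conj, re_conj. f_equal; ring. }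
    assert (K := re_le_Cmod (z * z * cps B z)).
    rewrite !Cmod_mult, Hz in K. apply Rabs_le_between in K. rewrite Hz.
    apply Rmult_le_compat_l with (r := rho ^ 2) in Q; [|apply pow2_ge_0].
    apply Rmult_lt_compat_r with (r := rho) in Hw; [|lra]. nra.
Qed.

(** * The Bohr radius *)

Definition growth_limit (alpha : R) : R :=
  1 + 2 * sum_from_2 (fun n => (-1) ^ (n - 1) / radius_weight alpha n).

Lemma weight_increasing (alpha : R) (n : nat) :
  0 <= alpha -> radius_weight alpha (S n) + 1 <= radius_weight alpha (S (S n)).
Proof.
  intros Ha. rewrite !weight_factor, !S_INR. assert (P := pos_INR n).
  assert (0 <= alpha * INR n) by now apply Rmult_le_pos. nra.
Qed.

(** Leibniz's bounds: the sum is at most its first term 1 and at least [1 - / w 2 + / w 3 - / w 4].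
    When [alpha = 0] the first two terms give exactly 1/2, so strictness, hence positivity of
    [growth_limit], comes from [w 3 < w 4]. *)
Lemma alternating_sum (alpha : R) :
  0 <= alpha ->
  exists l, is_series (fun n => (-1) ^ n / radius_weight alpha (S n)) l /\ 1 / 2 < l <= 1.
Proof.
  intros Ha. set (U := fun n => / radius_weight alpha (S n)).
  assert (HU : Un_decreasing U).
  { intros n. apply Rinv_le_contravar; [now apply weight_pos|].
    generalize (weight_increasing alpha n Ha); lra. }
  assert (HU0 : Un_cv U 0).
  { apply is_lim_seq_Reals.
    apply is_lim_seq_le_le with (fun _ => 0) (fun n => / (INR n + 1)).
    - intros n. split; [left; apply Rinv_0_lt_compat, weight_pos; auto|].
      rewrite <- S_INR. apply Rinv_le_contravar; [apply lt_0_INR; lia | now apply weight_ge].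
    - apply is_lim_seq_const.
    - apply (is_lim_seq_inv _ p_infty); [|discriminate].
      apply is_lim_seq_plus with p_infty 1; [apply is_lim_seq_INR|apply is_lim_seq_const|].
      reflexivity. }
  destruct (alternated_series U HU HU0) as [l Hl]. exists l. split.
  - apply is_series_Reals. exact Hl.
  - assert (B0 := alternated_series_ineq U l 0 HU HU0 Hl).
    assert (B1 := alternated_series_ineq U l 1 HU HU0 Hl).
    simpl in B0, B1. unfold tg_alt, U, radius_weight in *; simpl in *.
    assert (E1 : / (alpha * (1 * (1 * 1)) + 1 * (1 - alpha)) = 1) by (field; lra).
    rewrite E1 in *.
    set (w2 := alpha * ((1 + 1) * ((1 + 1) * 1)) + (1 + 1) * (1 - alpha)) in *.
    set (w3 := alpha * ((1 + 1 + 1) * ((1 + 1 + 1) * 1)) + (1 + 1 + 1) * (1 - alpha)) in *.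
    set (w4 := alpha * ((1 + 1 + 1 + 1) * ((1 + 1 + 1 + 1) * 1))
               + (1 + 1 + 1 + 1) * (1 - alpha)) in *.
    assert (/ w2 <= / 2) by (apply Rinv_le_contravar; unfold w2; lra).
    assert (/ w4 < / w3) by (apply Rinv_lt_contravar;
      [apply Rmult_lt_0_compat|]; unfold w3, w4; lra).
    lra.
Qed.

Lemma growth_limit_spec (alpha : R) :
  0 <= alpha ->
  is_series (growth_coef alpha) (growth_limit alpha) /\ 0 < growth_limit alpha <= 1.
Proof.
  intros Ha. destruct (alternating_sum alpha Ha) as (l & Hl & Hb).
  assert (Hw1 : radius_weight alpha 1 = 1) by (unfold radius_weight; simpl; ring).
  assert (E : growth_limit alpha = 2 * l - 1).
  { unfold growth_limit, sum_from_2.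
    rewrite (Series_ext _ (fun k => (-1) ^ (S k) / radius_weight alpha (S (S k))))
      by (intros k; do 2 f_equal; lia).
    assert (F := Series_incr_1 _ (ex_intro _ l Hl)). rewrite (is_series_unique _ _ Hl) in F.
    rewrite Hw1 in F. replace ((-1) ^ 0 / 1) with 1 in F by (simpl; field). lra. }
  rewrite E. split; [|lra].
  assert (G := is_series_geom 0 ltac:(rewrite Rabs_R0; lra)).
  replace (2 * l - 1) with (2 * l - / (1 - 0)) by (field; lra).
  apply is_Rseries_ext with (2 := is_Rseries_minus _ _ _ _ (is_Rseries_scal 2 _ _ Hl) G).
  intros [|n].
  - rewrite Hw1. simpl. field.
  - rewrite pow_i by lia. unfold growth_coef. field. apply Rgt_not_eq, weight_pos; auto.
Qed.

(** The radius of convergence is at least 1. If it is larger, the sum is continuous at 1; if it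
    equals 1, this is Abel's theorem. *)
Lemma abel_left_limit (c : nat -> R) (l : R) :
  disk_summable c -> is_series c l ->
  filterlim (PSeries c) (at_left 1) (locally l).
Proof.
  intros Hc Hl.
  assert (E : PSeries c 1 = l) by (rewrite PSeries_1; now apply is_series_unique).
  destruct (Rbar_le_lt_or_eq_dec 1 (CV_radius c)) as [H|H].
  - apply Rbar_not_lt_le. intros H.
    assert (P := CV_radius_ge_0 c). destruct (CV_radius c) as [r| |] eqn:Er; simpl in *; try easy.
    assert (K := disk_summable_CV_radius c r Hc ltac:(rewrite Rabs_right; lra)).
    rewrite Er in K. simpl in K. rewrite Rabs_right in K; lra.
  - rewrite <- E. intros P HP. apply filter_le_within.
    refine (proj1 (continuity_pt_filterlim _ _) _ P HP).
    apply PSeries_continuity. now rewrite Rabs_R1.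
  - rewrite <- E. assert (A := Abel c). rewrite <- H in A. apply A; simpl; auto; try lra.
    apply ex_pseries_1. now exists l.
Qed.

Definition growth_lower (alpha r : R) : R := r * PSeries (growth_coef alpha) r.

Lemma growth_lower_near_1 (alpha eps : R) :
  0 <= alpha -> 0 < eps ->
  exists r0, 0 <= r0 < 1 /\
    forall r, r0 < r < 1 -> Rabs (growth_lower alpha r - growth_limit alpha) < eps.
Proof.
  intros Ha He. destruct (growth_limit_spec alpha Ha) as [Hs Hb].
  assert (F := abel_left_limit _ _ (disk_summable_growth_coef alpha Ha) Hs).
  assert (He2 : 0 < eps / 2) by lra.
  destruct (proj1 (filterlim_locally _ _) F (mkposreal _ He2)) as [d Hd].
  assert (Hdp := cond_pos d).
  (* Half of [eps] pays for the convergence of the series, the other half for the factor [r], using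
     [growth_limit alpha <= 1]. *)
  exists (Rmax 0 (Rmax (1 - d) (1 - eps / 2))). split.
  { split; [apply Rmax_l|]. repeat apply Rmax_lub_lt; lra. }
  intros r [Hr1 Hr2].
  assert (0 < r) by (eapply Rle_lt_trans; [apply Rmax_l|exact Hr1]).
  assert (1 - d < r) by (eapply Rle_lt_trans; [|exact Hr1];
    eapply Rle_trans; [apply Rmax_l|apply Rmax_r]).
  assert (1 - eps / 2 < r) by (eapply Rle_lt_trans; [|exact Hr1];
    eapply Rle_trans; [apply Rmax_r|apply Rmax_r]).
  assert (K : Rabs (PSeries (growth_coef alpha) r - growth_limit alpha) < eps / 2).
  { apply (Hd r); auto. apply Rabs_def1; unfold minus, plus, opp; simpl; lra. }
  unfold growth_lower. apply Rabs_def2 in K. apply Rabs_def1; nra.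
Qed.

Definition inv_weight_sum (alpha r : R) : R :=
  sum_from_2 (fun n => r ^ n / radius_weight alpha n).

Lemma disk_summable_inv_weight (alpha : R) :
  0 <= alpha -> disk_summable (fun k => / radius_weight alpha (2 + k)).
Proof.
  intros Ha. apply disk_summable_bounded with 1. intros n.
  assert (W := weight_ge alpha (S n) Ha).
  assert (1 <= INR (S (S n))) by (rewrite S_INR; generalize (pos_INR (S n)); lra).
  rewrite Rabs_inv, Rabs_right by (simpl in *; lra).
  rewrite <- Rinv_1. apply Rinv_le_contravar; simpl in *; lra.
Qed.

Lemma inv_weight_sum_PSeries (alpha r : R) :
  inv_weight_sum alpha r = r ^ 2 * PSeries (fun k => / radius_weight alpha (2 + k)) r.
Proof.
  unfold inv_weight_sum, sum_from_2, PSeries. rewrite <- Series_scal_l.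
  apply Series_ext. intros k. unfold Rdiv. rewrite pow_add. ring.
Qed.

Lemma ex_inv_weight_sum (alpha r : R) :
  0 <= alpha -> 0 <= r < 1 ->
  ex_series (fun k => r ^ (2 + k) / radius_weight alpha (2 + k)).
Proof.
  intros Ha Hr.
  apply ex_Rseries_ext with (fun k => r ^ 2 * (/ radius_weight alpha (2 + k) * r ^ k)).
  - intros k. rewrite pow_add. unfold Rdiv. ring.
  - apply (@ex_series_scal R_AbsRing R_NormedModule).
    apply ex_Rseries_ext with (2 := disk_summable_inv_weight alpha Ha r Hr).
    intros k. rewrite Rabs_right; auto.
    apply Rle_ge, Rlt_le, Rinv_0_lt_compat, weight_pos; auto.
Qed.

Lemma inv_weight_sum_le (alpha r s : R) :
  0 <= alpha -> 0 <= r <= s -> s < 1 -> inv_weight_sum alpha r <= inv_weight_sum alpha s.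
Proof.
  intros Ha Hr Hs. apply Series_le; [|apply ex_inv_weight_sum; auto; lra].
  intros k. assert (W := weight_pos alpha (S k) Ha). simpl (2 + k)%nat.
  assert (0 < / radius_weight alpha (S (S k))) by now apply Rinv_0_lt_compat.
  split.
  - apply Rmult_le_pos; [apply pow_le|]; lra.
  - apply Rmult_le_compat_r; [lra|]. apply pow_incr; lra.
Qed.

Lemma radius_function_eq (alpha r : R) :
  radius_function alpha r = 4 * inv_weight_sum alpha r + 2 * r - growth_limit alpha.
Proof. unfold radius_function, growth_limit, inv_weight_sum. ring. Qed.

Lemma radius_function_increasing (alpha r s : R) :
  0 <= alpha -> 0 <= r < s -> s < 1 -> radius_function alpha r < radius_function alpha s.
Proof.
  intros Ha Hr Hs. rewrite !radius_function_eq.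
  assert (A := inv_weight_sum_le alpha r s Ha ltac:(lra) Hs). lra.
Qed.

(** The value at 0 is [- growth_limit alpha < 0]. At 1/2 the linear term is 1, which
    [growth_limit alpha] does not exceed, and the remaining sum is positive; so the root lies well
    inside the disk of convergence. *)
Lemma radius_function_root (alpha : R) :
  0 <= alpha -> exists r, 0 < r < 1 /\ radius_function alpha r = 0.
Proof.
  intros Ha. destruct (growth_limit_spec alpha Ha) as [_ Hb].
  assert (H0 : radius_function alpha 0 < 0).
  { rewrite radius_function_eq, inv_weight_sum_PSeries. simpl. lra. }
  assert (H1 : 0 < radius_function alpha (1 / 2)).
  { rewrite radius_function_eq.
    assert (Hex := ex_inv_weight_sum alpha (1 / 2) Ha ltac:(lra)).
    assert (Hpos : forall k, 0 < (1 / 2) ^ (2 + k) / radius_weight alpha (2 + k)).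
    { intros k. apply Rdiv_lt_0_compat; [apply pow_lt; lra|now apply weight_pos]. }
    assert (K := sum_n_le_is_series _ _ 0 (fun k => Rlt_le _ _ (Hpos k))
                   (Series_correct _ Hex)).
    rewrite sum_O in K. specialize (Hpos 0%nat).
    change (Series _) with (inv_weight_sum alpha (1 / 2)) in K. lra. }
  destruct (Ranalysis5.IVT_interv (radius_function alpha) 0 (1 / 2)) as (r & Hr & E); auto; [|lra|].
  - intros a Ha1.
    apply continuity_pt_ext with
      (fun r => 4 * (r ^ 2 * PSeries (fun k => / radius_weight alpha (2 + k)) r)
                + 2 * r - growth_limit alpha).
    { intros r. now rewrite radius_function_eq, inv_weight_sum_PSeries. }
    apply derivable_continuous_pt, ex_derive_Reals_0.
    assert (ex_derive (PSeries (fun k => / radius_weight alpha (2 + k))) a).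
    { apply ex_derive_PSeries, disk_summable_CV_radius;
        [now apply disk_summable_inv_weight|rewrite Rabs_right; lra]. }
    auto_derive; auto.
  - exists r. split; auto. split; [|lra].
    destruct (Req_dec r 0) as [F|F]; [rewrite F in E; lra|lra].
Qed.

Lemma cps_norm_le (A : nat -> C) (z : C) :
  cdisk_summable A -> Cmod z < 1 ->
  Cmod (cps A z) <= Series (fun n => Cmod (A n) * Cmod z ^ n).
Proof.
  intros HA Hz.
  apply (Cmod_is_cseries_le _ _ _ (cps_correct A z HA Hz)).
  apply is_Rseries_ext with (fun n => Cmod (A n) * Cmod z ^ n).
  - intros n. now rewrite Cmod_mult, Cmod_pow.
  - apply Series_correct, cdisk_summable_ex; auto. split; [apply Cmod_ge_0|auto].
Qed.

(** [s] is the sum in Bohr's inequality and also controls [Cmod (f z) - Cmod z]. Being used twice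
    and bounded by [2 * inv_weight_sum], it accounts for the factor 4 in the radius equation. *)
Lemma class_majorant_bound (alpha : R) (A B : nat -> C) (z : C) :
  0 <= alpha -> class_coefs alpha A B -> Cmod z < 1 ->
  let s := Series (fun k => (Cmod (A (S k)) + Cmod (B (S k))) * Cmod z ^ (2 + k)) in
  s <= 2 * inv_weight_sum alpha (Cmod z) /\
  Cmod (z * cps A z) + Cmod (z * cps B z) <= Cmod z + s.
Proof.
  intros Ha HC Hz s. assert (Hz0 := Cmod_ge_0 z). destruct (HC) as (HA & HB & HA0 & HB0 & _).
  set (r := Cmod z) in *. split.
  - unfold inv_weight_sum, sum_from_2. rewrite <- Series_scal_l.
    apply Series_le.
    + intros k. assert (P := pow_le r (2 + k) Hz0). split.
      * apply Rmult_le_pos; auto. generalize (Cmod_ge_0 (A (S k))) (Cmod_ge_0 (B (S k))); lra.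
      * replace (2 * (r ^ (2 + k) / radius_weight alpha (2 + k)))
          with (2 / radius_weight alpha (2 + k) * r ^ (2 + k)) by (unfold Rdiv; ring).
        apply Rmult_le_compat_r; auto. now apply class_coef_bound.
    + apply (@ex_series_scal R_AbsRing R_NormedModule). apply ex_inv_weight_sum; auto.
  - rewrite !Cmod_mult. fold r.
    assert (EA := cdisk_summable_ex A r HA (conj Hz0 Hz)).
    assert (EB := cdisk_summable_ex B r HB (conj Hz0 Hz)).
    apply Rle_trans with (r * (Series (fun n => Cmod (A n) * r ^ n)
                               + Series (fun n => Cmod (B n) * r ^ n))).
    + assert (KA := cps_norm_le A z HA Hz). assert (KB := cps_norm_le B z HB Hz).
      fold r in KA, KB. nra.
    + rewrite <- Series_plus by auto. rewrite Series_incr_1.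
      2: now apply (@ex_series_plus R_AbsRing R_NormedModule).
      rewrite HA0, HB0, Cmod_1, Cmod_0. right. unfold s.
      rewrite Rmult_plus_distr_l, <- Series_scal_l. simpl (r ^ 0). f_equal; [ring|].
      apply Series_ext. intros k. simpl. ring.
Qed.

(** If [Cmod w] were below the limit, it would be below [growth_lower alpha r] for some [r < 1].
    Points outside the image approach [w], so one of them would lie in the disk of that radius,
    whose points are all values of [f]. *)
Lemma class_boundary_far (alpha : R) (A B : nat -> C) (f : C -> C) (w : C) :
  0 <= alpha -> class_coefs alpha A B ->
  (forall z, Cmod z < 1 -> f z = (z * cps A z + Cconj (z * cps B z))%C) ->
  boundary (image_of_disk f) w -> growth_limit alpha <= Cmod w.
Proof.
  intros Ha HC Hf Hw. apply Rnot_lt_le. intros Hlt.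
  destruct (growth_lower_near_1 alpha (growth_limit alpha - Cmod w) Ha ltac:(lra))
    as (r0 & Hr0 & H).
  set (r := (r0 + 1) / 2). specialize (H r ltac:(unfold r; lra)).
  apply Rabs_def2 in H.
  destruct (Hw (growth_lower alpha r - Cmod w) ltac:(lra)) as (_ & u & Hu & Huw).
  apply Hu.
  assert (Hul : Cmod u < growth_lower alpha r).
  { replace u with ((u - w) + w)%C by ring. eapply Rle_lt_trans; [apply Cmod_triangle|]. lra. }
  destruct (class_image_contains_disk alpha A B (fun z => z * cps A z)%C
    (fun z => z * cps B z)%C r u Ha HC) as (z & Hz & E); auto.
  { unfold r; lra. }
  exists z. split; auto. now rewrite Hf.
Qed.

Lemma bohr_inequality_holds (alpha r3 : R) :
  0 <= alpha -> 0 < r3 < 1 -> radius_function alpha r3 = 0 ->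
  bohr_inequality_up_to alpha r3.
Proof.
  intros Ha Hr3 Hroot f h g a b Hclass Hexp z Hz Hzr.
  destruct (class_coefs_of_W0H alpha f h g a b Hclass Hexp) as (A & B & HC & Hab & Hh & Hg).
  destruct Hclass as [[(_ & _ & Hf & Hh0 & _ & Hg0) _] _].
  assert (Hf' : forall z, Cmod z < 1 -> f z = (z * cps A z + Cconj (z * cps B z))%C).
  { intros y Hy. rewrite Hf, Hh, Hg by auto. reflexivity. }
  assert (Hf0 : f (RtoC 0) = RtoC 0).
  { rewrite Hf', Cmult_0_l, Cmult_0_l.
    - unfold Cconj, RtoC, Cplus; simpl. f_equal; ring.
    - rewrite Cmod_0; lra. }
  unfold bohr_inequality, dist_to_set. rewrite Hf0.
  assert (Hz0 := Cmod_ge_0 z).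
  destruct (class_majorant_bound alpha A B z Ha HC Hz) as [K1 K2].
  set (s := Series _) in K1, K2.
  assert (Es : sum_from_2 (fun n => (Cmod (a n) + Cmod (b n)) * Cmod z ^ n) = s).
  { apply Series_ext. intros k. destruct (Hab k) as [-> ->]. reflexivity. }
  rewrite Es.
  assert (Hfz : Cmod (f z) <= Cmod z + s).
  { rewrite Hf' by auto. eapply Rle_trans; [apply Cmod_triangle|]. now rewrite Cmod_conj. }
  assert (Hm : Cmod (f z) + Cmod z + s <= growth_limit alpha).
  { assert (R := radius_function_eq alpha r3). rewrite Hroot in R.
    assert (Q := inv_weight_sum_le alpha (Cmod z) r3 Ha ltac:(lra) ltac:(lra)). lra. }
  (* A lower bound for every distance is enough for the extended infimum, whether or not the
     boundary is empty. *)
  apply Rbar_le_trans with (Finite (growth_limit alpha)); [exact Hm|].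
  apply (proj2 (Glb_Rbar_correct _)). intros d (w & Hw & ->).
  replace (w - RtoC 0)%C with w by ring.
  now apply (class_boundary_far alpha A B f).
Qed.

(** * The extremal function *)

(** [weighted alpha] turns these into 1, 2, 2, ..., the coefficients of [(1 + z) / (1 - z)], the
    equality case of Caratheodory and Harnack. They agree with [growth_coef] up to the sign
    [(-1) ^ n]. *)
Definition extremal_coef (alpha : R) (n : nat) : R :=
  match n with O => 1 | S _ => 2 / radius_weight alpha (S n) end.

Lemma disk_summable_extremal (alpha : R) :
  0 <= alpha -> disk_summable (extremal_coef alpha).
Proof.
  intros Ha. apply disk_summable_bounded with 2. intros [|n]; simpl.
  - rewrite Rabs_R1. lra.
  - assert (W := weight_ge alpha (S n) Ha).
    assert (1 <= INR (S (S n))) by (rewrite S_INR; generalize (pos_INR (S n)); lra).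
    rewrite Rabs_right.
    + apply Rmult_le_reg_r with (radius_weight alpha (S (S n))); [lra|]. field_simplify; lra.
    + apply Rle_ge, Rlt_le, Rdiv_lt_0_compat; lra.
Qed.

Lemma cdisk_summable_RtoC (c : nat -> R) :
  disk_summable c -> cdisk_summable (fun n => RtoC (c n)).
Proof.
  apply disk_summable_le. intros n. rewrite Cmod_R, Rabs_Rabsolu. lra.
Qed.

Lemma cps_real (c : nat -> R) (t : R) :
  disk_summable c -> Rabs t < 1 -> cps (fun n => RtoC (c n)) (RtoC t) = RtoC (PSeries c t).
Proof.
  intros Hc Ht. apply cps_unique.
  - now apply cdisk_summable_RtoC.
  - now rewrite Cmod_R.
  - apply is_cseries_iff. split.
    + apply is_Rseries_ext with (fun n => c n * t ^ n).
      * intros n. now rewrite <- RtoC_pow, <- RtoC_mult.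
      * apply (is_pseries_R c t). apply PSeries_correct. now apply ex_pseries_disk.
    + apply is_Rseries_ext with (fun n => 0 * 0 ^ n).
      * intros n. rewrite <- RtoC_pow, <- RtoC_mult, im_RtoC. ring.
      * assert (G := is_Rseries_scal 0 _ _ (is_series_geom 0 ltac:(rewrite Rabs_R0; lra))).
        rewrite Rmult_0_l in G. exact G.
Qed.

Lemma cps_conj (c : nat -> R) (z : C) :
  disk_summable c -> Cmod z < 1 ->
  cps (fun n => RtoC (c n)) (Cconj z) = Cconj (cps (fun n => RtoC (c n)) z).
Proof.
  intros Hc Hz. assert (HC := cdisk_summable_RtoC c Hc).
  apply cps_unique; [auto|now rewrite Cmod_conj|].
  destruct (proj1 (is_cseries_iff _ _) (cps_correct _ z HC Hz)) as [H1 H2].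
  assert (E : forall n, (RtoC (c n) * Cconj z ^ n)%C = Cconj (RtoC (c n) * z ^ n)).
  { intros n. rewrite Cmult_conj, Cpow_conj. f_equal. unfold Cconj, RtoC; simpl.
    now rewrite Ropp_0. }
  apply is_cseries_iff. split.
  - rewrite re_conj. apply is_Rseries_ext with (2 := H1). intros n. now rewrite E, re_conj.
  - rewrite im_conj. apply (is_Rseries_scal (-1)) in H2.
    replace (- Im _) with (-1 * Im (cps (fun n => RtoC (c n)) z)) by ring.
    apply is_Rseries_ext with (2 := H2). intros n. rewrite E, im_conj. ring.
Qed.

Lemma cps_0 (z : C) : Cmod z < 1 -> cps (fun _ => RtoC 0) z = RtoC 0.
Proof.
  intros Hz.
  assert (H0 : disk_summable (fun _ => 0)).
  { apply disk_summable_bounded with 0. intros _. rewrite Rabs_R0. lra. }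
  apply cps_unique; auto; [now apply (cdisk_summable_RtoC (fun _ => 0))|].
  assert (H := is_cseries_scal 0 _ _ (cps_correct _ z (cdisk_summable_RtoC _ H0) Hz)).
  rewrite Cmult_0_l in H. apply is_cseries_ext with (2 := H). intros n; ring.
Qed.

(** The real part in question is the Poisson kernel. Bounding its partial sums keeps the margin
    [(1 - s) / (1 + s)] in the limit, so the inequality stays strict. *)
Lemma extremal_class_coefs (alpha : R) :
  0 <= alpha ->
  class_coefs alpha (fun n => RtoC (extremal_coef alpha n)) (fun _ => RtoC 0).
Proof.
  intros Ha.
  assert (HE := cdisk_summable_RtoC _ (disk_summable_extremal alpha Ha)).
  split; [auto|split; [|split; [reflexivity|split; [reflexivity|]]]].
  - apply (cdisk_summable_RtoC (fun _ => 0)), disk_summable_bounded with 0.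
    intros _. rewrite Rabs_R0. lra.
  - intros z Hz.
    rewrite (cps_ext (weighted alpha (fun _ => RtoC 0)) (fun _ => RtoC 0))
      by (intros n; unfold weighted; ring).
    rewrite cps_0, Cmod_0 by auto.
    assert (S := cps_correct _ z (cdisk_summable_weighted alpha _ HE) Hz).
    apply is_cseries_iff in S as [S _].
    set (s := Cmod z) in *. assert (Hs : 0 <= s) by apply Cmod_ge_0.
    apply Rlt_le_trans with ((1 - s) / (1 + s)); [apply Rdiv_lt_0_compat; lra|].
    assert (L1 : is_lim_seq (fun M => (1 - s) / (1 + s) - 2 * s ^ (M + 1) / (1 - s))
                   ((1 - s) / (1 + s))).
    { replace (Finite ((1 - s) / (1 + s)))
        with (Finite ((1 - s) / (1 + s) - 2 / (1 - s) * 0)) by (f_equal; ring).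
      apply is_lim_seq_ext with (fun M => (1 - s) / (1 + s) - 2 / (1 - s) * s ^ (M + 1)).
      { intros n. field; lra. }
      apply is_lim_seq_minus'; [apply is_lim_seq_const|].
      apply (is_lim_seq_scal_l _ _ 0).
      apply (is_lim_seq_incr_n (fun n => s ^ n) 1). apply is_lim_seq_geom.
      rewrite Rabs_right; lra. }
    assert (HM : forall M, (1 - s) / (1 + s) - 2 * s ^ (M + 1) / (1 - s)
      <= sum_n (fun n => Re (weighted alpha (fun n => RtoC (extremal_coef alpha n)) n * z ^ n)) M).
    { intros M. rewrite Nat.add_1_r.
      rewrite (sum_n_ext _ (poisson_term z)); [apply poisson_sum_lower; auto|].
      intros [|n]; unfold weighted, extremal_coef, poisson_term.
      - simpl. ring.
      - rewrite Cmult_assoc, <- !RtoC_mult, <- weight_factor, re_scal_l.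
        assert (W := weight_pos alpha (Datatypes.S n) Ha). f_equal. field. lra. }
    exact (is_lim_seq_le _ _ (Finite _) (Finite _) HM L1 S).
Qed.

(** The converse passage, from quotient coefficients to a member of the class; [pred] restores the
    shift by one caused by dividing by [z]. *)
Lemma W0H_of_class_coefs (alpha : R) (A B : nat -> C) :
  class_coefs alpha A B ->
  class_W0H alpha (fun z => z * cps A z + Cconj (z * cps B z))%C
    (fun z => z * cps A z)%C (fun z => z * cps B z)%C /\
  expansions (fun z => z * cps A z)%C (fun z => z * cps B z)%C
    (fun n => A (pred n)) (fun n => B (pred n)).
Proof.
  intros (HA & HB & HA0 & HB0 & Hineq).
  destruct (operator_of_power_series alpha (fun z => z * cps A z)%C A HA) as [DA OA]; auto.
  destruct (operator_of_power_series alpha (fun z => z * cps B z)%C B HB) as [DB OB]; auto.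
  assert (H0 : Cmod (RtoC 0) < 1) by (rewrite Cmod_0; lra).
  assert (D0 : forall Q, cdisk_summable Q -> cps (succ_mul Q) (RtoC 0) = Q 0%nat).
  { intros Q HQ. rewrite cps_mul_z by (auto using cdisk_summable_succ).
    unfold succ_mul at 1. simpl. ring. }
  split.
  - split; [split|].
    + split; [|split; [|split; [|split; [|split]]]].
      * intros z Hz. eexists. now apply DA.
      * intros z Hz. eexists. now apply DB.
      * reflexivity.
      * ring.
      * rewrite (is_C_derive_unique _ _ _ (DA _ H0)), D0; auto.
      * ring.
    + rewrite (is_C_derive_unique _ _ _ (DB _ H0)), D0; auto.
    + intros z Hz. rewrite OA, OB by auto. now apply Hineq.
  - assert (HS : forall Q, cdisk_summable Q -> forall z, Cmod z < 1 ->
      is_cseries (fun k => Q (S k) * z ^ (2 + k))%C (z * cps Q z - Q 0%nat * z)%C).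
    { intros Q HQ z Hz.
      assert (H := is_cseries_incr_1 _ _ (is_cseries_scal z _ _ (cps_correct Q z HQ Hz))).
      replace (z * cps Q z - Q 0%nat * z)%C
        with (z * cps Q z - z * (Q 0%nat * z ^ 0))%C by (simpl; ring).
      apply is_cseries_ext with (2 := H). intros n. simpl. ring. }
    intros z Hz. split; simpl pred.
    + replace (z * cps A z - z)%C with (z * cps A z - A 0%nat * z)%C by (rewrite HA0; ring).
      now apply HS.
    + replace (z * cps B z)%C with (z * cps B z - B 0%nat * z)%C by (rewrite HB0; ring).
      now apply HS.
Qed.

(** The zero co-analytic part is kept so that the general statements on [class_coefs] apply
    verbatim. *)
Definition extremal (alpha : R) (z : C) : C :=
  (z * cps (fun n => RtoC (extremal_coef alpha n)) z
   + Cconj (z * cps (fun _ => RtoC 0) z))%C.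

Lemma extremal_eq (alpha : R) (z : C) :
  Cmod z < 1 -> extremal alpha z = (z * cps (fun n => RtoC (extremal_coef alpha n)) z)%C.
Proof.
  intros Hz. unfold extremal. rewrite cps_0 by auto. rewrite Cmult_0_r.
  replace (Cconj 0) with (RtoC 0); [ring|]. unfold Cconj, RtoC; simpl. now rewrite Ropp_0.
Qed.

(** The constant may depend on the two points, since only its sign matters later: for injectivity
    and for monotonicity on the real axis. *)
Lemma extremal_monotone (alpha : R) (x y : C) :
  0 <= alpha -> Cmod x < 1 -> Cmod y < 1 ->
  exists c, 0 < c /\ c * Cmod (x - y) ^ 2 <= cdot (extremal alpha x - extremal alpha y) (x - y).
Proof.
  intros Ha Hx Hy. set (rho := Rmax (Cmod x) (Cmod y)).
  assert (Hr : rho < 1) by now apply Rmax_lub_lt.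
  assert (Hr0 : 0 <= rho) by (eapply Rle_trans; [apply (Cmod_ge_0 x)|apply Rmax_l]).
  exists ((1 - rho) / (1 + rho)). split; [apply Rdiv_lt_0_compat; lra|].
  apply (class_strongly_monotone alpha _ _ (fun z => z * _)%C (fun z => z * _)%C rho x y Ha
           (extremal_class_coefs alpha Ha)); auto; [apply Rmax_l|apply Rmax_r].
Qed.

Lemma extremal_pos (alpha r : R) :
  0 <= alpha -> 0 <= r < 1 ->
  extremal alpha (RtoC r) = RtoC (r + 2 * inv_weight_sum alpha r).
Proof.
  intros Ha Hr. assert (Hr1 : Rabs r < 1) by (rewrite Rabs_right; lra).
  assert (HE := disk_summable_extremal alpha Ha).
  rewrite extremal_eq, cps_real by (auto; now rewrite Cmod_R).
  rewrite <- RtoC_mult. f_equal. unfold PSeries.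
  assert (X := ex_pseries_disk _ _ HE Hr1). apply ex_pseries_R in X.
  change (r * Series (fun n => extremal_coef alpha n * r ^ n)
          = r + 2 * inv_weight_sum alpha r).
  rewrite Series_incr_1 by auto. unfold inv_weight_sum, sum_from_2.
  rewrite Rmult_plus_distr_l, <- !Series_scal_l. f_equal; [simpl; ring|].
  apply Series_ext. intros k. unfold extremal_coef. simpl (2 + k)%nat.
  rewrite <- !tech_pow_Rmult. unfold Rdiv. ring.
Qed.

Lemma extremal_neg (alpha r : R) :
  0 <= alpha -> 0 <= r < 1 -> extremal alpha (RtoC (- r)) = RtoC (- growth_lower alpha r).
Proof.
  intros Ha Hr. assert (Hr1 : Rabs (- r) < 1) by (rewrite Rabs_Ropp, Rabs_right; lra).
  rewrite extremal_eq, cps_real by (auto using disk_summable_extremal; now rewrite Cmod_R).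
  rewrite <- RtoC_mult. f_equal. unfold growth_lower.
  replace (PSeries (extremal_coef alpha) (- r)) with (PSeries (growth_coef alpha) r); [ring|].
  apply Series_ext. intros [|n]; unfold extremal_coef, growth_coef; [reflexivity|].
  replace (- r) with (-1 * r) by ring. rewrite Rpow_mult_distr. unfold Rdiv. ring.
Qed.

(** Real coefficients make the function commute with conjugation, so [z] and [Cconj z] have the same
    real image; strong monotonicity makes them equal. *)
Lemma extremal_real_preimage (alpha : R) (z : C) (u : R) :
  0 <= alpha -> Cmod z < 1 -> extremal alpha z = RtoC u -> z = RtoC (Re z).
Proof.
  intros Ha Hz E. assert (Hcz : Cmod (Cconj z) < 1) by now rewrite Cmod_conj.
  assert (E2 : extremal alpha (Cconj z) = RtoC u).
  { rewrite extremal_eq, cps_conj by (auto using disk_summable_extremal).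
    rewrite <- Cmult_conj, <- extremal_eq, E by auto.
    unfold Cconj, RtoC; simpl. now rewrite Ropp_0. }
  destruct (extremal_monotone alpha z (Cconj z) Ha Hz Hcz) as (c & Hc & H).
  rewrite E, E2 in H. replace (RtoC u - RtoC u)%C with (RtoC 0 * 0)%C in H by ring.
  rewrite cdot_scal_l, Rmult_0_l in H.
  assert (P := pow2_ge_0 (Cmod (z - Cconj z))).
  assert (K : Cmod (z - Cconj z) ^ 2 = 0) by nra.
  assert (K0 : Cmod (z - Cconj z) = 0) by (apply Rsqr_0_uniq; rewrite Rsqr_pow2; exact K).
  apply Cmod_eq_0, (proj2 (Ceq_minus _ _)) in K0.
  destruct z as [x y]. unfold Cconj in K0; simpl in K0. injection K0 as K0.
  unfold RtoC; simpl. f_equal. lra.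
Qed.

Lemma extremal_boundary (alpha : R) :
  0 <= alpha -> boundary (image_of_disk (extremal alpha)) (RtoC (- growth_limit alpha)).
Proof.
  intros Ha eps Heps. destruct (growth_limit_spec alpha Ha) as [_ Hm]. split.
  - destruct (growth_lower_near_1 alpha eps Ha Heps) as (r0 & Hr0 & H).
    set (r := (r0 + 1) / 2). specialize (H r ltac:(unfold r; lra)).
    exists (RtoC (- growth_lower alpha r)). split.
    + exists (RtoC (- r)). split.
      * unfold unit_disk. rewrite Cmod_R, Rabs_Ropp, Rabs_right; unfold r; lra.
      * apply extremal_neg; auto. unfold r; lra.
    + rewrite <- RtoC_minus, Cmod_R, <- Rabs_Ropp.
      replace (- (- growth_lower alpha r - - growth_limit alpha))
        with (growth_lower alpha r - growth_limit alpha) by ring. exact H.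
  (* A preimage would be a real [x]. For [x >= 0] the image is nonnegative; for [x < 0] it is
     [- growth_lower alpha (- x)], which monotonicity keeps from falling below
     [- growth_limit alpha]. *)
  - exists (RtoC (- growth_limit alpha - eps / 2)). split.
    + intros (z & Hz & E).
      assert (Ez := extremal_real_preimage alpha z _ Ha Hz E). set (x := Re z) in Ez.
      unfold unit_disk in Hz. rewrite Ez in E, Hz. rewrite Cmod_R in Hz.
      apply Rabs_def2 in Hz. destruct (Rle_lt_dec 0 x) as [Hx|Hx].
      * rewrite extremal_pos in E by (auto; lra). apply RtoC_inj in E.
        assert (Q := inv_weight_sum_le alpha 0 x Ha ltac:(lra) ltac:(lra)).
        rewrite (inv_weight_sum_PSeries alpha 0) in Q. simpl (0 ^ 2) in Q. lra.
      * replace x with (- - x) in E by ring. rewrite extremal_neg in E by (auto; lra).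
        apply RtoC_inj in E.
        destruct (growth_lower_near_1 alpha (eps / 2) Ha ltac:(lra)) as (r0 & Hr0 & H).
        (* Beyond [- x], for the comparison by monotonicity, and beyond [r0], where the value is
           within [eps / 2] of the limit. *)
        set (r := (Rmax r0 (- x) + 1) / 2).
        assert (M1 := Rmax_l r0 (- x)). assert (M2 := Rmax_r r0 (- x)).
        assert (M3 : Rmax r0 (- x) < 1) by (apply Rmax_lub_lt; lra).
        specialize (H r ltac:(unfold r; lra)). apply Rabs_def2 in H.
        destruct (extremal_monotone alpha (RtoC (- - x)) (RtoC (- r)) Ha) as (c & Hc & Q).
        { rewrite Cmod_R, Ropp_involutive. apply Rabs_def1; lra. }
        { rewrite Cmod_R. apply Rabs_def1; unfold r; lra. }
        rewrite !extremal_neg in Q by (auto; unfold r; lra).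
        rewrite <- !RtoC_minus in Q.
        assert (P := pow2_ge_0 (Cmod (RtoC (- - x - - r)))).
        assert (N : cdot (RtoC (- growth_lower alpha (- x) - - growth_lower alpha r))
                  (RtoC (- - x - - r))
                = (growth_lower alpha r - growth_lower alpha (- x)) * (r + x))
          by (unfold cdot; simpl; ring).
        rewrite N in Q. assert (0 < r + x) by (unfold r; lra). nra.
    + rewrite <- RtoC_minus, Cmod_R. apply Rabs_def1; lra.
Qed.

Lemma bohr_inequality_fails (alpha r3 rho : R) :
  0 <= alpha -> 0 < r3 < 1 -> radius_function alpha r3 = 0 -> r3 < rho ->
  ~ bohr_inequality_up_to alpha rho.
Proof.
  intros Ha Hr3 Hroot Hrho H.
  (* [rho] may exceed 1; capping it keeps the test point inside the disk and strictly beyond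
     [r3]. *)
  set (r := (r3 + Rmin rho 1) / 2).
  assert (Hmin : r3 < Rmin rho 1) by (apply Rmin_glb_lt; lra).
  assert (M1 := Rmin_l rho 1). assert (M2 := Rmin_r rho 1).
  assert (Hr : r3 < r < 1) by (unfold r; lra).
  assert (Hpos := radius_function_increasing alpha r3 r Ha ltac:(lra) ltac:(lra)).
  rewrite Hroot, radius_function_eq in Hpos.
  assert (Cr : Cmod (RtoC r) = r) by (rewrite Cmod_R, Rabs_right; lra).
  destruct (W0H_of_class_coefs alpha _ _ (extremal_class_coefs alpha Ha)) as [HW HX].
  specialize (H (extremal alpha) _ _ _ _ HW HX (RtoC r)). unfold unit_disk in H. rewrite Cr in H.
  specialize (H ltac:(lra) ltac:(unfold r in *; lra)).
  unfold bohr_inequality in H.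
  assert (E0 : extremal alpha (RtoC 0) = RtoC 0).
  { rewrite extremal_eq by (rewrite Cmod_0; lra). apply Cmult_0_l. }
  assert (HD : Rbar_le (dist_to_set (extremal alpha (RtoC 0))
                 (boundary (image_of_disk (extremal alpha)))) (growth_limit alpha)).
  { apply (proj1 (Glb_Rbar_correct _)). exists (RtoC (- growth_limit alpha)).
    split; [now apply extremal_boundary|].
    rewrite E0. replace (RtoC (- growth_limit alpha) - RtoC 0)%C
      with (RtoC (- growth_limit alpha)) by ring.
    destruct (growth_limit_spec alpha Ha) as [_ Hm].
    rewrite Cmod_R, Rabs_Ropp, Rabs_right; lra. }
  assert (K := Rbar_le_trans _ _ _ H HD). unfold Rbar_le in K. cbv beta in K.
  rewrite Cr in K.
  assert (Es : sum_from_2 (fun n => (Cmod (RtoC (extremal_coef alpha (pred n)))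
                  + Cmod (RtoC 0)) * r ^ n) = 2 * inv_weight_sum alpha r).
  { unfold inv_weight_sum, sum_from_2. rewrite <- Series_scal_l. apply Series_ext.
    intros k. simpl pred. unfold extremal_coef. simpl (2 + k)%nat.
    assert (W := weight_pos alpha (S k) Ha).
    rewrite Cmod_0, Cmod_R, Rabs_right; [unfold Rdiv; ring|].
    apply Rle_ge, Rlt_le, Rdiv_lt_0_compat; lra. }
  rewrite Es in K. rewrite extremal_pos, Cmod_R in K by (auto; lra).
  assert (Q := Rle_abs (r + 2 * inv_weight_sum alpha r)). lra.
Qed.

Theorem theorem3p3 :
  forall alpha : R, 0 <= alpha < 1 ->
  exists r3 : R,
    (0 < r3 < 1 /\ radius_function alpha r3 = 0 /\
     (forall r : R, 0 < r < 1 -> radius_function alpha r = 0 -> r = r3)) /\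
    bohr_inequality_up_to alpha r3 /\
    (forall rho : R, r3 < rho -> ~ bohr_inequality_up_to alpha rho).
Proof.
  intros alpha [Ha _]. destruct (radius_function_root alpha Ha) as (r3 & Hr3 & Hroot).
  exists r3. split; [|split].
  - split; [auto|split; [auto|]]. intros r Hr E.
    destruct (Rtotal_order r r3) as [H|[H|H]]; auto.
    + assert (K := radius_function_increasing alpha r r3 Ha ltac:(lra) ltac:(lra)). lra.
    + assert (K := radius_function_increasing alpha r3 r Ha ltac:(lra) ltac:(lra)). lra.
  - now apply bohr_inequality_holds.
  - intros rho Hrho. now apply (bohr_inequality_fails alpha r3).
Qed.
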